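(* Consider the discrete symplectic system $y_{k+1}=\mathcal S_k y_k$, $k=0,\dots,N$, with $\mathcal S_k=\begin{pmatrix}\mathcal A_k&\mathcal B_k\\ \mathcal C_k&\mathcal D_k\end{pmatrix}\in Sp(2n)$, and for $M=0,1,\dots,N+1$ let $\mathcal X^{[M]}_k$ be the upper $n\times n$ block of its principal solution $\mathcal Y^{[M]}_k$ at $M$. Let $S^{[0]}_{1,2,\dots,N+2}$ be the symmetric $(N+2)n\times(N+2)n$ matrix with $n\times n$ blocks $$S^{[0]}_{1,\dots,N+2}(i,j)=\mathcal X^{[i-1]\,T}_{j-1}=-\mathcal X^{[j-1]}_{i-1},\qquad S^{[0]}_{1,\dots,N+2}(j,i)=S^{[0]}_{1,\dots,N+2}(i,j)^T,\qquad j\ge i,\ i,j=1,\dots,N+2;$$ in particular, $S^{[0]}_{1,\dots,N+2}(i+1,i)=S^{[0]}_{1,\dots,N+2}(i,i+1)^T=\mathcal B_{i-1}$. Then $$l^*(\mathcal Y^{[0]},0,N+1)=l(\mathcal Y^{[N+1]},0,N+1)=\operatorname{ind}(-S^{[0]}_{1,2,\dots,N+2}),\qquad N\ge0,$$ $$l(\mathcal Y^{[0]},0,N+1)=l^*(\mathcal Y^{[N+1]},0,N+1)=\operatorname{ind}(-\bar S^{[0]}_{1,2,\dots,N+1}),\qquad N\ge1,$$ where $$\bar S^{[0]}_{1,2,\dots,N+1}=\begin{pmatrix}0&\tilde{\mathcal M}_d\\ \tilde{\mathcal M}_d^T&S^{[0]}_{2,3,\dots,N+1}-\mathcal D_d-\mathcal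 D_d^T\end{pmatrix},$$ $S^{[0]}_{2,3,\dots,N+1}$ is the principal submatrix of $S^{[0]}_{1,\dots,N+2}$ formed by block rows and columns $2,\dots,N+1$, and $$\tilde{\mathcal M}_d=\bigl(I-\mathcal X_0^{[N+1]\,\dagger}\mathcal X_0^{[N+1]}\bigr)\mathcal N_d,\qquad \mathcal D_d=-\mathcal K_d^T\,\mathcal X_{N+1}^{[0]\,\dagger}\,\mathcal N_d,$$ $$\mathcal K_d=\bigl(\mathcal X_1^{[0]\,T}\;\mathcal X_2^{[0]\,T}\dots\mathcal X_N^{[0]\,T}\bigr),\qquad \mathcal N_d=\bigl(\mathcal X_1^{[N+1]\,T}\;\mathcal X_2^{[N+1]\,T}\dots\mathcal X_N^{[N+1]\,T}\bigr).$$ In the formula for $\bar S^{[0]}_{1,\dots,N+1}$ the matrix $\tilde{\mathcal M}_d$ can be replaced by $\mathcal M_d=\bigl(I-\mathcal X_{N+1}^{[0]\,\dagger}\mathcal X_{N+1}^{[0]}\bigr)\mathcal K_d$.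
   Context: $\mathcal{J}=\begin{pmatrix}0&I\\-I&0\end{pmatrix}\in\mathbb{R}^{2n\times 2n}$, $w(Y,\hat Y)=Y^T\mathcal{J}\hat Y$, $Sp(2n)=\{Z\in\mathbb{R}^{2n\times2n}: Z^T\mathcal{J}Z=\mathcal{J}\}$; $\mathbf b=(0\;\,I)^T$ is the $2n\times n$ matrix with upper block $0$ and lower block $I$. For a real symmetric matrix $A$, $\operatorname{ind}A$ is the number of negative eigenvalues counted with multiplicity. $A^{\dagger}$ is the Moore–Penrose pseudoinverse; $\mathcal X_k^{[M]\,T}$ and $\mathcal X_k^{[M]\,\dagger}$ denote transpose and pseudoinverse of $\mathcal X_k^{[M]}$. A frame is a real $2n\times n$ matrix $Y$ with $w(Y,Y)=0$ and $\operatorname{rank}Y=n$. For frames $Y=\binom{X}{U}$, $\hat Y=\binom{\hat X}{\hat U}$ ($n\times n$ blocks) put $\mathcal M=(I-X^{\dagger}X)\,w(Y,\hat Y)$, $\mathcal T=I-\mathcal M^{\dagger}\mathcal M$, $\mathcal P=\mathcal T\,w(Y,\hat Y)^T X^{\dagger}\hat X\,\mathcal T$ (symmetric), and define the comparative index and dual comparative index $\mu(Y,\hat Y)=\operatorname{rank}\mathcal M+\operatorname{ind}\mathcal P$, $\mu^*(Y,\hat Y)=\operatorname{rank}\mathcal M+\operatorname{ind}(-\mathcal P)$. A conjoined basis of the system is a sequence of frames $\mathcal Y_k$, $k=0,\dots,N+1$, with $\mathcal Y_{k+1}=\mathcal S_k\mathcal Y_k$. The principal solution $\mathcal Y^{[M]}$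 at $M\in\{0,\dots,N+1\}$ is the conjoined basis with $\mathcal Y^{[M]}_M=\mathbf b$. The total numbers of forward and backward focal points of a conjoined basis $\mathcal Y$ are $l(\mathcal Y,0,N+1)=\sum_{k=0}^N\mu(\mathcal Y_{k+1},\mathcal S_k\mathbf b)$ and $l^*(\mathcal Y,0,N+1)=\sum_{k=0}^N\mu^*(\mathcal Y_k,\mathcal S_k^{-1}\mathbf b)$. *)

(* Defs.v *)
From mathcomp Require Import all_boot all_order all_algebra.
From mathcomp Require Import polyrcf.

Set Implicit Arguments.
Unset Strict Implicit.
Unset Printing Implicit Defensive.

Import Order.TTheory GRing.Theory Num.Theory.
Local Open Scope ring_scope.

Section MoorePenrose.
Variable R : realFieldType.

Definition penrose m n (A : 'M[R]_(m, n)) (B : 'M[R]_(n, m)) : bool :=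
  [&& A *m B *m A == A, B *m A *m B == B,
      (A *m B)^T == A *m B & (B *m A)^T == B *m A].

Lemma penrose_uniq m n (A : 'M[R]_(m, n)) (B C : 'M[R]_(n, m)) :
  penrose A B -> penrose A C -> B = C.
Proof.
move=> /and4P[/eqP ABA /eqP BAB /eqP tAB /eqP tBA].
move=> /and4P[/eqP ACA /eqP CAC /eqP tAC /eqP tCA].
have eAB : A *m B = A *m C.
  rewrite -{1}ACA -mulmxA -tAC -tAB -trmx_mul.
  by rewrite (mulmxA (A *m B)) ABA tAC.
have eBA : B *m A = C *m A.
  rewrite -{1}ACA !mulmxA -mulmxA -tBA -tCA -trmx_mul.
  by rewrite -mulmxA (mulmxA A B) ABA tCA.
by rewrite -BAB eBA -mulmxA eAB mulmxA.
Qed.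

Lemma row_free_gram_unit m n (A : 'M[R]_(m, n)) :
  row_free A -> A *m A^T \in unitmx.
Proof.
move=> freeA; rewrite -row_free_unit; apply: inj_row_free => v vG0.
have : v *m A *m (v *m A)^T = 0.
  by rewrite trmx_mul !mulmxA -(mulmxA v) vG0 mul0mx.
move=> uu0; apply/eqP; rewrite -(mulmx_free_eq0 _ freeA).
move: (v *m A) uu0 => u /matrixP/(_ 0 0).
rewrite mxE [RHS]mxE => /eqP.
have sq j : u 0 j * u^T j 0 = u 0 j ^+ 2 by rewrite mxE.
under eq_bigr do rewrite sq.
rewrite psumr_eq0 => [|j _]; last exact: sqr_ge0.
move=> /allP u0; apply/eqP/rowP => j; rewrite [RHS]mxE.
by have := u0 j (mem_index_enum j); rewrite /= sqrf_eq0 => /eqP.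
Qed.

Lemma penrose_exists m n (A : 'M[R]_(m, n)) : exists B, penrose A B.
Proof.
have [r [C [F [uC uF defA]]]] : exists r,
    exists C : 'M[R]_(m, r), exists F : 'M[R]_(r, n),
    [/\ C^T *m C \in unitmx, F *m F^T \in unitmx & A = C *m F].
  exists (\rank A), (col_base A), (row_base A); split; last by rewrite mulmx_base.
    rewrite -{2}(trmxK (col_base A)); apply: row_free_gram_unit.
    by rewrite /row_free mxrank_tr; exact: col_base_full.
  exact/row_free_gram_unit/row_base_free.
set G := invmx (F *m F^T); set H := invmx (C^T *m C).
have tG : G^T = G by rewrite /G trmx_inv trmx_mul trmxK.
have tH : H^T = H by rewrite /H trmx_inv trmx_mul trmxK.
pose B := F^T *m G *m H *m C^T.
have AB : A *m B = C *m H *m C^T.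
  by rewrite /B defA !mulmxA -(mulmxA C F) -(mulmxA C _ G) mulmxV ?mulmx1.
have BA : B *m A = F^T *m G *m F.
  rewrite /B defA !mulmxA -(mulmxA _ C^T C) -(mulmxA _ H).
  by rewrite mulVmx ?mulmx1.
exists B; apply/and4P; split; apply/eqP.
- by rewrite AB defA !mulmxA -(mulmxA _ C^T C) -(mulmxA C H) mulVmx ?mulmx1.
- rewrite BA /B !mulmxA -(mulmxA _ F F^T) -(mulmxA _ G (F *m F^T)).
  by rewrite mulVmx ?mulmx1.
- by rewrite AB !trmx_mul trmxK tH mulmxA.
- by rewrite BA !trmx_mul trmxK tG mulmxA.
Qed.

Definition mppinv m n (A : 'M[R]_(m, n)) : 'M[R]_(n, m) :=
  xchoose (penrose_exists A).

Lemma mppinvP m n (A : 'M[R]_(m, n)) : penrose A (mppinv A).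
Proof. exact: xchooseP. Qed.

End MoorePenrose.

(* Not the library's partial inverse pinvmx, which need not be Moore-Penrose. *)
Notation "A ^†" := (mppinv A) (at level 2, format "A ^†") : ring_scope.

Section Symplectic.
Variable R : rcfType.
Variable n : nat.

(* Multiplicities are algebraic, i.e. those of the roots of char_poly. *)
Definition ind m (A : 'M[R]_m) : nat :=
  \sum_(x <- rootsR (char_poly A) | x < 0) mup x (char_poly A).

Definition Jmx : 'M[R]_(n + n) := block_mx 0 1%:M (- 1%:M) 0.

Definition symplectic (Z : 'M[R]_(n + n)) : Prop := Z^T *m Jmx *m Z = Jmx.

Definition wronskian (Y Yh : 'M[R]_(n + n, n)) : 'M[R]_n := Y^T *m Jmx *m Yh.

Definition frame (Y : 'M[R]_(n + n, n)) : Prop :=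
  wronskian Y Y = 0 /\ \rank Y = n.

Definition bframe : 'M[R]_(n + n, n) := col_mx 0 1%:M.

Section ComparativeIndex.
Variables Y Yh : 'M[R]_(n + n, n).

Definition ciM : 'M[R]_n :=
  (1%:M - (usubmx Y)^† *m usubmx Y) *m wronskian Y Yh.

Definition ciT : 'M[R]_n := 1%:M - ciM^† *m ciM.

Definition ciP : 'M[R]_n :=
  ciT *m (wronskian Y Yh)^T *m (usubmx Y)^† *m usubmx Yh *m ciT.

Definition comp_index : nat := (\rank ciM + ind ciP)%N.

Definition dual_comp_index : nat := (\rank ciM + ind (- ciP))%N.

End ComparativeIndex.

Section System.
Variables (N : nat) (S : nat -> 'M[R]_(n + n)).

(* Sequences are indexed by nat; only S k for k <= N and Y k for k <= N.+1
   are ever constrained or used. *)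
Definition conjoined_basis (Y : nat -> 'M[R]_(n + n, n)) : Prop :=
  (forall k, (k <= N.+1)%N -> frame (Y k)) /\
  (forall k, (k <= N)%N -> Y k.+1 = S k *m Y k).

Definition principal_solution (M : nat) (Y : nat -> 'M[R]_(n + n, n)) : Prop :=
  conjoined_basis Y /\ Y M = bframe.

Definition forward_focal (Y : nat -> 'M[R]_(n + n, n)) : nat :=
  \sum_(0 <= k < N.+1) comp_index (Y k.+1) (S k *m bframe).

Definition backward_focal (Y : nat -> 'M[R]_(n + n, n)) : nat :=
  \sum_(0 <= k < N.+1) dual_comp_index (Y k) (invmx (S k) *m bframe).

End System.

(* In this section, Y M k stands for the value at time k of the principal
   solution at M.  Block indices are 0-based: the block (i, j) below is the
   block (i + 1, j + 1) in 1-based notation. *)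
Section BlockMatrices.
Variables (N : nat) (Y : nat -> nat -> 'M[R]_(n + n, n)).

Definition Xblk (M k : nat) : 'M[R]_n := usubmx (Y M k).

Definition Sblk (i j : nat) : 'M[R]_n :=
  if (i <= j)%N then (Xblk i j)^T else ((Xblk j i)^T)^T.

Definition Smx : 'M[R]_(\sum_(i < N.+2) n, \sum_(j < N.+2) n) :=
  \mxblock_(i < N.+2, j < N.+2) Sblk i j.

(* Deletes the first and the last block rows and columns. *)
Definition Sinner : 'M[R]_(\sum_(i < N) n, \sum_(j < N) n) :=
  \mxblock_(i < N, j < N) submxblock Smx (inord i.+1) (inord j.+1).

Definition Kd : 'M[R]_(n, \sum_(j < N) n) :=
  \mxrow_(j < N) (Xblk 0 j.+1)^T.

Definition Nd : 'M[R]_(n, \sum_(j < N) n) :=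
  \mxrow_(j < N) (Xblk N.+1 j.+1)^T.

Definition Dd : 'M[R]_(\sum_(i < N) n, \sum_(j < N) n) :=
  - (Kd^T *m (Xblk 0 N.+1)^† *m Nd).

Definition Md_tilde : 'M[R]_(n, \sum_(j < N) n) :=
  (1%:M - (Xblk N.+1 0)^† *m Xblk N.+1 0) *m Nd.

Definition Md : 'M[R]_(n, \sum_(j < N) n) :=
  (1%:M - (Xblk 0 N.+1)^† *m Xblk 0 N.+1) *m Kd.

Definition Sbar (L : 'M[R]_(n, \sum_(j < N) n)) :
    'M[R]_(n + \sum_(i < N) n, n + \sum_(j < N) n) :=
  block_mx 0 L L^T (Sinner - Dd - Dd^T).

End BlockMatrices.
End Symplectic.

Arguments bframe {R n}.
Arguments Jmx {R n}.

(* Main.v *)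
Require Import Defs.
From mathcomp Require Import all_boot all_order all_algebra.
From mathcomp Require Import reals.
From mathcomp Require Import polyrcf complex zify.

Set Implicit Arguments.
Unset Strict Implicit.
Unset Printing Implicit Defensive.

Import Order.TTheory GRing.Theory Num.Theory.
Local Open Scope ring_scope.

(* By constancy of the Wronskian everything is expressed through the frames
   V i := Y i 0: the block (i, j), i <= j, of S is w(V i, V j), and the k-th
   term of each focal point count is an index of the triple formed by V 0 or
   V N.+1 together with V k and V k.+1.  A Lagrangian subspace transversal to
   all V i turns them into graphs of symmetric matrices A i, with
   w(V i, V j) = G i^T (A j - A i) G j, and then -S is congruent to
     diag(A 1 - A 0, ..., A N.+1 - A N, A 0 - A N.+1)
   up to a positive factor.  For three frames b, Yh, Y, eliminating the outer
   pair b, Y from the corresponding S by its pseudoinverse leaves a bordered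
   matrix whose index is mu for S and mu^* for -S. Hence
     mu   = ind (Ab - Ah) + ind (Ah - Ay) - ind (Ab - Ay),
     mu^* = ind (Ah - Ab) + ind (Ay - Ah) - ind (Ay - Ab),
   and the four counts telescope.  Eliminating the outer pair V 0, V N.+1 from
   -S in the same way produces Sbar. *)

(** * The index of a symmetric matrix *)

Section Forms.
Variable R : realFieldType.

Definition qf n (A : 'M[R]_n) (v : 'rV[R]_n) : R := (v *m A *m v^T) 0 0.

Lemma qf_congr m n (P : 'M[R]_(m, n)) (A : 'M[R]_n) v :
  qf (P *m A *m P^T) v = qf A (v *m P).
Proof. by rewrite /qf trmx_mul !mulmxA. Qed.

Lemma qf_diag n (d v : 'rV[R]_n) :
  qf (diag_mx d) v = \sum_i d 0 i * v 0 i ^+ 2.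
Proof.
rewrite /qf mul_mx_diag mxE; apply: eq_bigr => i _.
by rewrite !mxE mulrAC mulrC.
Qed.

Lemma qf1_ge0 n (v : 'rV[R]_n) : 0 <= qf 1%:M v.
Proof.
rewrite /qf mulmx1 mxE; apply: sumr_ge0 => i _.
by rewrite mxE -expr2 sqr_ge0.
Qed.

Lemma qf1_eq0 n (v : 'rV[R]_n) : (qf 1%:M v == 0) = (v == 0).
Proof.
apply/idP/eqP => [|->]; last by rewrite /qf !mul0mx mxE.
rewrite /qf mulmx1 mxE psumr_eq0 => [/allP v0|i _]; last first.
  by rewrite mxE -expr2 sqr_ge0.
apply/rowP => i; have := v0 i (mem_index_enum i).
by rewrite !mxE /= mulf_eq0 orbb => /eqP.
Qed.

End Forms.

(** * Spectral theorem and Sylvester's law of inertia *)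

Section Spectral.
Variable R : rcfType.
Local Notation C := R[i].
Local Notation toC := (real_complex R).

(** [R[i]] is algebraically closed, so a complex eigenvalue exists. Symmetry makes it real, and then
    the real and the imaginary part of its eigenvector each satisfy the eigenvalue equation; one of
    them is nonzero. *)
Lemma sym_eigenvalue n (A : 'M[R]_n.+1) : A^T = A ->
  exists x (v : 'rV[R]_n.+1), v != 0 /\ v *m A = x *: v.
Proof.
move=> symA; pose AC := map_mx toC A.
have [z] : exists z, root (char_poly AC) z.
  by apply/closed_rootP; rewrite size_char_poly.
rewrite -eigenvalue_root_char => /eigenvalueP[v vA v0].
pose a := map_mx (@complex.Re R) v; pose b := map_mx (@complex.Im R) v.
have vab j : v 0 j = ((a 0 j) +i* (b 0 j))%C by rewrite !mxE; case: (v 0 j).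
have aA : a *m A = complex.Re z *: a - complex.Im z *: b.
  apply/rowP => j; have /rowP/(_ j) := vA; rewrite !mxE => /(congr1 (@complex.Re R)).
  rewrite raddf_sum /= => e; transitivity (complex.Re (z * v 0 j)).
    rewrite -e; apply: eq_bigr => k _; rewrite !mxE.
    by case: (v 0 k) => p q /=; rewrite mulr0 subr0.
  by case: (z) => p q; case: (v 0 j) => r s.
have bA : b *m A = complex.Re z *: b + complex.Im z *: a.
  apply/rowP => j; have /rowP/(_ j) := vA; rewrite !mxE => /(congr1 (@complex.Im R)).
  rewrite raddf_sum /= => e; transitivity (complex.Im (z * v 0 j)).
    rewrite -e; apply: eq_bigr => k _; rewrite !mxE.
    by case: (v 0 k) => p q /=; rewrite mulr0 add0r.
  by case: (z) => p q; case: (v 0 j) => r s.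
have ab0 : (a != 0) || (b != 0).
  apply: contraNT v0; rewrite negb_or !negbK => /andP[/eqP a0 /eqP b0].
  by apply/eqP/rowP => j; rewrite vab a0 b0 !mxE.
(* Symmetry forces Im z (|a|^2 + |b|^2) = 0. *)
have y0 : complex.Im z = 0.
  have: (a *m A *m b^T) 0 0 = (b *m A *m a^T) 0 0.
    rewrite -[a *m A *m b^T]trmxK mxE; congr (fun_of_matrix _ 0 0).
    by rewrite !trmx_mul trmxK symA mulmxA.
  have ba : (b *m a^T) 0 0 = (a *m b^T) 0 0.
    by rewrite -[b *m a^T]trmxK mxE trmx_mul trmxK.
  have -> : (a *m A *m b^T) 0 0 = complex.Re z * (a *m b^T) 0 0 - complex.Im z * qf 1%:M b.
    by rewrite aA mulmxBl -!scalemxAl /qf mulmx1 !mxE.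
  have -> : (b *m A *m a^T) 0 0 = complex.Re z * (b *m a^T) 0 0 + complex.Im z * qf 1%:M a.
    by rewrite bA mulmxDl -!scalemxAl /qf mulmx1 !mxE.
  rewrite ba => /addrI /eqP; rewrite eq_sym -subr_eq0 opprK -mulrDr.
  rewrite mulf_eq0 => /orP[/eqP//|].
  rewrite paddr_eq0 ?qf1_ge0 // !qf1_eq0 => /andP[a0 b0].
  by move: ab0; rewrite a0 b0.
exists (complex.Re z); case/orP: ab0 => [a0|b0]; [exists a|exists b].
  by rewrite aA y0 scale0r subr0.
by rewrite bA y0 scale0r addr0.
Qed.

(** [H] is the reflection along v - e, which exchanges the unit vectors v and e; for v = e that
    direction vanishes and the identity serves. *)
Lemma householder n (v : 'rV[R]_n.+1) : qf 1%:M v = 1 ->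
  exists H : 'M[R]_n.+1, [/\ H^T = H, H *m H = 1%:M & v *m H = delta_mx 0 0].
Proof.
move=> nv; have [ve|ve] := eqVneq v (delta_mx 0 0).
  by exists 1%:M; rewrite trmx1 !mulmx1.
pose e : 'rV[R]_n.+1 := delta_mx 0 0; pose u := v - e; pose c := qf 1%:M u.
have c0 : c != 0 by rewrite qf1_eq0 subr_eq0.
have uu : u *m u^T = c%:M.
  by rewrite [LHS]mx11_scalar /c /qf mulmx1.
have vv : v *m v^T = 1%:M by rewrite [LHS]mx11_scalar; move: nv; rewrite /qf mulmx1 => ->.
have ee : e *m e^T = 1%:M.
  by rewrite /e trmx_delta mul_delta_mx; apply/matrixP=> i j; rewrite !ord1 !mxE !eqxx.
exists (1%:M - (2 / c) *: (u^T *m u)); split.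
- by rewrite linearB /= linearZ /= trmx_mul trmxK trmx1.
- rewrite mulmxBr mulmx1 mulmxBl mul1mx -!scalemxAr -!scalemxAl.
  rewrite mulmxA -(mulmxA u^T u) uu -mulmxA mul_scalar_mx -scalemxAr !scalerA.
  rewrite -(mulrA (2 / c)) divfK // mulrDr mulr1 scalerDl.
  by rewrite opprB addrK subrK.
(* Since v and e have equal length, v - e has the same product with v as with -e, so its square is
   twice its product with v. *)
have vu : v *m u^T = (c / 2)%:M.
  have: u *m u^T = v *m u^T + v *m u^T.
    rewrite {1}/u mulmxBl; congr (_ + _).
    rewrite /u linearB /= !mulmxBr opprB vv ee; congr (_ - _).
    rewrite [LHS]mx11_scalar [RHS]mx11_scalar -[e *m v^T]trmxK trmx_mul trmxK.
    by rewrite [X in X%:M]mxE.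
  rewrite uu -mulr2n => /(congr1 (fun M : 'M_1 => 2^-1 *: M)).
  by rewrite -scaler_nat scalerA mulVf ?pnatr_eq0 // scale1r scale_scalar_mx mulrC.
rewrite mulmxBr mulmx1 -scalemxAr mulmxA vu mul_scalar_mx scalerA.
rewrite mulrA divfK // divff ?pnatr_eq0 // scale1r /u; by rewrite opprB addrC subrK.
Qed.

(** A reflection carries a unit eigenvector to the first basis vector; by symmetry the conjugated
    matrix splits off a 1 x 1 block, and induction treats the rest. *)
Lemma spectral n (A : 'M[R]_n) : A^T = A ->
  exists (P : 'M[R]_n) (d : 'rV[R]_n),
    P *m P^T = 1%:M /\ A = P *m diag_mx d *m P^T.
Proof.
elim: n A => [|n IHn] A symA.
  exists 1%:M, 0; rewrite trmx1 mulmx1; split=> //.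
  by apply/matrixP => - [].
have [x [v [v0 vA]]] := sym_eigenvalue symA.
have nv_gt0 : 0 < qf 1%:M v by rewrite lt_def qf1_eq0 v0 qf1_ge0.
pose s := (Num.sqrt (qf 1%:M v))^-1.
have [H [tH HH uH]] : exists H : 'M[R]_n.+1,
    [/\ H^T = H, H *m H = 1%:M & s *: v *m H = delta_mx 0 0].
  apply: householder; rewrite /qf mulmx1 linearZ /= -scalemxAl -scalemxAr scalerA.
  have -> : v *m v^T = (qf 1%:M v)%:M by rewrite [LHS]mx11_scalar /qf mulmx1.
  rewrite mxE mxE eqxx mulr1n -[qf _ _ in LHS]sqr_sqrtr ?ltW // /s.
  by rewrite -expr2 -exprMn mulVf ?expr1n // sqrtr_eq0 -ltNge.
pose B : 'M_(1 + n) := H *m A *m H.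
have tB : B^T = B by rewrite !trmx_mul tH symA mulmxA.
have eB : (delta_mx 0 0 : 'rV_(1 + n)) *m B = x *: delta_mx 0 0.
  rewrite -uH /B !mulmxA -(mulmxA _ H H) HH mulmx1 -!scalemxAl vA.
  by rewrite -!scalemxAl !scalerA mulrC.
have B0 j : B 0 j = x *+ (j == 0).
  have /rowP/(_ j) := eB; rewrite -rowE !mxE eqxx => ->.
  by rewrite mulr_natr.
have l0 (i : 'I_1) : lshift n i = ord0 by apply: val_inj; rewrite /= ord1.
have B0l (i : 'I_1) j : B (lshift n i) j = x *+ (j == ord0) by rewrite l0; exact: B0.
have defB : B = block_mx x%:M 0 0 (drsubmx B).
  rewrite -[B in LHS]submxK; congr block_mx; apply/matrixP => i j.
  - by rewrite [LHS]mxE mxE B0l mxE !l0 !ord1.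
  - by rewrite [LHS]mxE mxE B0l mxE.
  - by rewrite -tB [LHS]mxE mxE mxE B0l mxE.
have [|P [d [PP defD]]] := IHn (drsubmx B).
  by rewrite trmx_drsub tB.
pose Q : 'M_(1 + n) := block_mx 1%:M 0 0 P.
have tQ : Q^T = block_mx 1%:M 0 0 P^T by rewrite tr_block_mx trmx1 !trmx0.
have QQ : Q *m Q^T = 1%:M.
  rewrite tQ mulmx_block !mulmx0 !mul0mx !addr0 add0r mulmx1 PP.
  by rewrite -scalar_mx_block.
pose d' : 'rV_(1 + n) := row_mx x%:M d.
have BQ : B = Q *m diag_mx d' *m Q^T.
  have -> : diag_mx d' = block_mx x%:M 0 0 (diag_mx d).
    rewrite diag_mx_row; congr block_mx; apply/matrixP => i j.
    by rewrite !ord1 !mxE.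
  rewrite defB defD tQ !mulmx_block.
  by rewrite !(mulmx0, mul0mx, addr0, add0r, mulmx1, mul1mx).
exists (H *m Q), d'; rewrite trmx_mul tH; split.
  by rewrite mulmxA -(mulmxA H Q) QQ mulmx1.
transitivity (H *m B *m H); last by rewrite BQ !mulmxA.
by rewrite /B !mulmxA HH mul1mx -mulmxA HH mulmx1.
Qed.

Lemma char_poly_spectral n (P : 'M[R]_n) (d : 'rV[R]_n) : P *m P^T = 1%:M ->
  char_poly (P *m diag_mx d *m P^T) = \prod_i ('X - (d 0 i)%:P).
Proof.
move=> PP; transitivity (char_poly (diag_mx d)); last first.
  rewrite char_poly_trig ?diag_mx_is_trig //.
  by apply: eq_bigr => i _; rewrite mxE eqxx.
rewrite /char_poly /char_poly_mx !map_mxM /=.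
have PPX : map_mx polyC P *m map_mx polyC P^T = 1%:M by rewrite -map_mxM PP map_mx1.
rewrite -[X in X - _]mulmx1 -PPX mulmxA -scalar_mxC -mulmxBl -mulmxBr !det_mulmx.
by rewrite mulrAC -det_mulmx PPX det1 mul1r.
Qed.

(** Turns the algebraic multiplicities in [ind] into a count: each diagonal entry adds one to the
    multiplicity of exactly one root, so the two sums can be exchanged. *)
Lemma ind_spectral n (P : 'M[R]_n) (d : 'rV[R]_n) : P *m P^T = 1%:M ->
  ind (P *m diag_mx d *m P^T) = #|[set i | d 0 i < 0]|.
Proof.
move=> PP; rewrite /ind char_poly_spectral // -sum1_card.
have nz : \prod_i ('X - (d 0 i)%:P) != 0.
  by apply/prodf_neq0 => i _; rewrite polyXsubC_eq0.
have mupE x : mup x (\prod_i ('X - (d 0 i)%:P)) = (\sum_i (d 0%R i == x))%N.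
  apply: (big_ind2 (fun p k => p != 0 -> mup x p = k)) => //.
  - by move=> _; rewrite mupNroot // root1.
  - move=> p1 k1 p2 k2 h1 h2; rewrite mulf_eq0 negb_or => /andP[p1n p2n].
    by rewrite mupM // h1 // h2.
  - by move=> i _ _; have := mup_XsubCX 1 x (d 0 i); rewrite expr1 => ->; case: eqP.
under eq_bigr do rewrite mupE.
rewrite exchange_big [RHS]big_mkcond /=; apply: eq_bigr => i _; rewrite inE.
have di : d 0 i \in rootsR (\prod_i ('X - (d 0 i)%:P)).
  rewrite -roots_on_rootsR // inE /= rootE horner_prod (bigD1 i) //=.
  by rewrite hornerXsubC subrr mul0r.
rewrite big_mkcond (bigD1_seq (d 0 i)) ?uniq_roots //= eqxx big1 ?addn0 // => x.
by rewrite eq_sym => /negPf ->; case: ifP.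
Qed.

Definition selmx n (S : {set 'I_n}) : 'M[R]_(#|S|, n) :=
  \matrix_(i, j) (enum_val i == j)%:R.

Lemma selmx_outside n (S : {set 'I_n}) (w : 'rV_#|S|) j :
  j \notin S -> (w *m selmx S) 0 j = 0.
Proof.
move=> jS; rewrite mxE big1 // => i _; rewrite mxE.
case: eqP => [ij|_]; last by rewrite mulr0.
by move: jS; rewrite -ij enum_valP.
Qed.

Lemma selmx_tr n (S : {set 'I_n}) : selmx S *m (selmx S)^T = 1%:M.
Proof.
apply/matrixP => i j; rewrite mxE (bigD1 (enum_val i)) //= big1 => [|k ki].
  by rewrite !mxE eqxx mul1r addr0 (inj_eq enum_val_inj) eq_sym.
by rewrite !mxE eq_sym (negPf ki) mul0r.
Qed.

(* A negative definite space for A of dimension ind A meets the pullback of a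
   nonnegative space for B of codimension ind B trivially. *)
Lemma ind_le p q (A : 'M[R]_p) (B : 'M[R]_q) (Q : 'M[R]_(p, q)) :
    A^T = A -> B^T = B -> (forall v, qf A v < 0 -> qf B (v *m Q) < 0) ->
  (ind A <= ind B)%N.
Proof.
move=> symA symB AB.
have [P1 [d1 [PP1 defA]]] := spectral symA.
have [P2 [d2 [PP2 defB]]] := spectral symB.
have P2P : P2^T *m P2 = 1%:M by exact: mulmx1C.
have P1P : P1^T *m P1 = 1%:M by exact: mulmx1C.
rewrite defA defB !ind_spectral //.
set S := [set i | d1 0 i < 0]; set T := [set i | d2 0 i < 0].
(* [U] spans the negative eigenspaces of [A], [W] the nonnegative ones of [B]. Independence of the
   rows of [U *m Q] and [W] in dimension q gives #|S| + (q - #|T|) <= q. *)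
pose U := selmx S *m P1^T; pose W := selmx (~: T) *m P2^T.
suff: row_free (col_mx (U *m Q) W).
  rewrite /row_free => /eqP rk.
  have := rank_leq_col (col_mx (U *m Q) W).
  by rewrite rk -[X in (_ <= X)%N -> _]card_ord -(cardsC T) leq_add2r.
apply: inj_row_free => xy; rewrite -[xy]hsubmxK mul_row_col.
set x := lsubmx xy; set y := rsubmx xy => /eqP.
rewrite addrC addr_eq0 -mulNmx => /eqP xy0.
have qB : 0 <= qf B (y *m W).
  rewrite defB qf_congr qf_diag; apply: sumr_ge0 => i _.
  rewrite /W -!mulmxA P2P mulmx1.
  have [iT|] := boolP (i \in ~: T); last first.
    by move=> /selmx_outside ->; rewrite expr0n mulr0.
  by rewrite mulr_ge0 ?sqr_ge0 //; move: iT; rewrite !inE -leNgt.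
have qA : x != 0 -> qf A (x *m U) < 0.
  move=> x0; rewrite defA qf_congr qf_diag /U -!mulmxA P1P mulmx1.
  have F i : i \in S -> d1 0 i * (x *m selmx S) 0 i ^+ 2 <= 0.
    by rewrite inE => iS; rewrite nmulr_rle0 ?sqr_ge0.
  rewrite lt_def; apply/andP; split; last first.
    rewrite -oppr_ge0 -sumrN; apply: sumr_ge0 => i _.
    have [iS|/selmx_outside->] := boolP (i \in S); first by rewrite oppr_ge0 F.
    by rewrite expr0n mulr0 oppr0.
  apply: contraNneq x0 => /esym sum0.
  suff xs0 : x *m selmx S = 0.
    by rewrite -[x]mulmx1 -selmx_tr mulmxA xs0 mul0mx.
  apply/rowP => i; rewrite [RHS]mxE.
  have [iS|/selmx_outside->//] := boolP (i \in S).
  have: \sum_i - (d1 0 i * (x *m selmx S) 0 i ^+ 2) == 0.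
    by rewrite sumrN sum0 oppr0.
  rewrite psumr_eq0 => [/allP/(_ i (mem_index_enum i))|j _]; last first.
    have [jS|/selmx_outside->] := boolP (j \in S); first by rewrite oppr_ge0 F.
    by rewrite expr0n mulr0 oppr0.
  rewrite /= oppr_eq0 mulf_eq0 sqrf_eq0.
  by move: iS; rewrite inE => /lt_eqF -> /eqP.
have x0 : x = 0.
  apply/eqP/negPn/negP => /qA/AB; rewrite -mulmxA ltNge.
  have -> : x *m (U *m Q) = - (y *m W) by rewrite xy0 mulNmx opprK.
  by rewrite /qf [(- _)^T]linearN /= mulmxN !mulNmx opprK qB.
suff y0 : y = 0 by rewrite x0 y0 row_mx0.
have -> : y = y *m W *m P2 *m (selmx (~: T))^T.
  by rewrite /W mulmxA -(mulmxA _ P2^T) P2P mulmx1 -mulmxA selmx_tr mulmx1.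
by rewrite xy0 x0 oppr0 !mul0mx.
Qed.

(** Sylvester's law where [P] and [Q] need be neither square nor mutually inverse: each congruence
    gives one inequality. This lets null directions be added or dropped. *)
Lemma ind_congr p q (A : 'M[R]_p) (B : 'M[R]_q) P Q :
    A^T = A -> B^T = B -> A = P *m B *m P^T -> B = Q *m A *m Q^T ->
  ind A = ind B.
Proof.
move=> symA symB defA defB; apply/eqP; rewrite eqn_leq.
rewrite (ind_le symA symB (Q := P)); last first.
  by move=> v; rewrite {1}defA qf_congr.
by rewrite (ind_le symB symA (Q := Q)) // => v; rewrite {1}defB qf_congr.
Qed.

Lemma ind_congr_unit p (A B P : 'M[R]_p) : B^T = B -> P \in unitmx ->
  A = P *m B *m P^T -> ind A = ind B.
Proof.
move=> symB uP defA; apply: (@ind_congr _ _ _ _ P (invmx P)) => //.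
  by rewrite defA !trmx_mul trmxK symB mulmxA.
by rewrite defA !mulmxA mulVmx // mul1mx -mulmxA -trmx_mul mulVmx // trmx1 mulmx1.
Qed.

Lemma ind_scale p (A : 'M[R]_p) c : A^T = A -> 0 < c -> ind (c *: A) = ind A.
Proof.
move=> symA c0; apply: (@ind_congr_unit _ _ _ (Num.sqrt c)%:M) => //.
  by rewrite unitmxE det_scalar unitrX // unitfE sqrtr_eq0 -ltNge.
rewrite tr_scalar_mx mul_mx_scalar mul_scalar_mx scalerA -expr2 sqr_sqrtr //.
exact: ltW.
Qed.

Lemma rank_ind p (A : 'M[R]_p) : A^T = A -> \rank A = (ind A + ind (- A))%N.
Proof.
move=> symA; have [P [d [PP defA]]] := spectral symA.
have uP : P \in unitmx by case: (mulmx1_unit PP).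
have -> : ind (- A) = #|[set i | 0 < d 0 i]|.
  have -> : - A = P *m diag_mx (- d) *m P^T.
    by rewrite defA linearN /= mulmxN mulNmx.
  rewrite ind_spectral //; apply: eq_card => i.
  by rewrite !inE mxE oppr_lt0.
rewrite defA ind_spectral // mxrankMfree ?row_free_unit ?unitmx_tr //.
rewrite (eqmxMfull _ (_ : row_full P)) ?row_full_unit // -cardsUI.
set I := _ :&: _; have -> : I = set0.
  by apply/setP => i; rewrite !inE; case: ltgtP.
rewrite cards0 addn0; set S := _ :|: _.
have dS i : i \notin S -> d 0 i = 0.
  by rewrite !inE negb_or -!leNgt => /andP[? ?]; apply/eqP; rewrite eq_le; apply/andP.
have dS0 i : i \in S -> d 0 i != 0 by rewrite !inE -neq_lt.
apply/eqP; rewrite eqn_leq; apply/andP; split.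
  have -> : diag_mx d = (selmx S)^T *m (selmx S *m diag_mx d).
    apply/matrixP => i j; rewrite mulmxA mul_mx_diag mxE mxE.
    have [<-|ij] := eqVneq i j; last first.
      rewrite mulr0n mxE big1 ?mul0r // => k _; rewrite !mxE.
      case: eqP => [->|_]; last by rewrite mul0r.
      by rewrite (negPf ij) mulr0.
    have [iS|/dS ->] := boolP (i \in S); last by rewrite mulr0 mul0rn.
    rewrite mxE (bigD1 (enum_rank_in iS i)) //= big1 => [|k ki]; rewrite !mxE.
      by rewrite enum_rankK_in // eqxx mulr1 addr0 mul1r.
    case: eqP => [ki'|_]; last by rewrite mul0r.
    by move: ki; rewrite -(inj_eq enum_val_inj) enum_rankK_in // ki' eqxx.
  by apply: leq_trans (mxrankM_maxr _ _) (rank_leq_row _).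
(* Zero entries of [d] give the default inverse 0 in [e], but [selmx S] picks only nonzero ones. *)
pose e : 'rV[R]_p := \row_i (d 0 i)^-1.
have eq1 : selmx S *m (diag_mx e *m diag_mx d) = selmx S.
  apply/matrixP => i j; rewrite mulmxA !mul_mx_diag !mxE.
  case: eqP => [<-|_]; last by rewrite !mul0r.
  by rewrite mul1r mulVf // dS0 // enum_valP.
have : row_free (selmx S) by apply/row_freeP; exists (selmx S)^T; rewrite selmx_tr.
rewrite /row_free => /eqP {1}<-; rewrite -eq1 mulmxA.
exact: mxrankM_maxr.
Qed.

End Spectral.

(** * Index of block matrices *)

Section Blocks.
Variable R : rcfType.

Lemma sym_block p q (A : 'M[R]_p) (B : 'M_(p, q)) (D : 'M_q) :
  A^T = A -> D^T = D -> (block_mx A B B^T D)^T = block_mx A B B^T D.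
Proof. by move=> sA sD; rewrite tr_block_mx sA sD trmxK. Qed.

Lemma sym_block_diag p q (A : 'M[R]_p) (D : 'M_q) :
  A^T = A -> D^T = D -> (block_mx A 0 0 D)^T = block_mx A 0 0 D.
Proof. by move=> sA sD; rewrite tr_block_mx sA sD !trmx0. Qed.

Lemma ind_block_diag p q (A : 'M[R]_p) (B : 'M[R]_q) : A^T = A -> B^T = B ->
  ind (block_mx A 0 0 B) = (ind A + ind B)%N.
Proof.
move=> symA symB.
have [P1 [d1 [PP1 ->]]] := spectral symA.
have [P2 [d2 [PP2 ->]]] := spectral symB.
pose P := block_mx P1 0 0 P2.
have tP : P^T = block_mx P1^T 0 0 P2^T by rewrite tr_block_mx !trmx0.
have PP : P *m P^T = 1%:M.
  rewrite tP mulmx_block !(mulmx0, mul0mx, addr0, add0r) PP1 PP2.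
  by rewrite -scalar_mx_block.
have -> : block_mx (P1 *m diag_mx d1 *m P1^T) 0 0 (P2 *m diag_mx d2 *m P2^T) =
          P *m diag_mx (row_mx d1 d2) *m P^T.
  by rewrite tP diag_mx_row !mulmx_block !(mulmx0, mul0mx, addr0, add0r).
rewrite !ind_spectral // -!sum1_card big_mkcond big_split_ord /=.
congr (_ + _)%N; rewrite [RHS]big_mkcond /=; apply: eq_bigr => i _.
  by rewrite !inE row_mxEl.
by rewrite !inE row_mxEr.
Qed.

Lemma ind_cast p q (e : p = q) (A : 'M[R]_p) : ind (castmx (e, e) A) = ind A.
Proof. by case: q / e; rewrite castmx_id. Qed.

Lemma ind0 p : ind (0 : 'M[R]_p) = 0%N.
Proof.
have := rank_ind (trmx0 R p p); rewrite mxrank0.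
by case: (ind _).
Qed.

Lemma ind_mxdiag m (p_ : 'I_m -> nat) (D : forall i, 'M[R]_(p_ i)) :
  (forall i, (D i)^T = D i) -> ind (\mxdiag_i D i) = (\sum_i ind (D i))%N.
Proof.
elim: m p_ D => [|m IHm] p_ D symD.
  suff -> : \mxdiag_i D i = 0 by rewrite ind0 big_ord0.
  apply/matrixP => i; exfalso; case: i => i /=.
  by move=> lti; have := lti; rewrite big_ord0.
rewrite mxdiag_recl ind_cast ind_block_diag ?symD // ?big_ord_recl ?IHm //.
by rewrite tr_mxdiag; apply: eq_mxdiag => i; rewrite symD.
Qed.

(** Congruence by diag(1, -1) changes the sign of the matrix, so it has as many positive as negative
    eigenvalues, and its rank is twice that of [M]. *)
Lemma ind_offdiag p q (M : 'M[R]_(p, q)) : ind (block_mx 0 M M^T 0) = \rank M.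
Proof.
set A := block_mx _ _ _ _.
have symA : A^T = A by apply: sym_block; rewrite trmx0.
have symNA : (- A)^T = - A by rewrite linearN /= symA.
have indN : ind A = ind (- A).
  pose J : 'M[R]_(p + q) := block_mx 1%:M 0 0 (- 1%:M).
  have tJ : J^T = J by apply: sym_block_diag; rewrite ?linearN /= trmx1.
  have JJ : J *m J = 1%:M.
    rewrite mulmx_block !(mulmx0, mul0mx, addr0, add0r) mulmx1 mulmxN mulNmx.
    by rewrite mulmx1 opprK -scalar_mx_block.
  have defA : A = J *m (- A) *m J^T.
    rewrite tJ opp_block_mx !mulmx_block !(mulmx0, mul0mx, addr0, add0r, oppr0).
    by rewrite !(mul1mx, mulNmx, mulmx1, mulmxN, opprK).
  by apply: (@ind_congr_unit _ _ _ _ J) => //; case: (mulmx1_unit JJ).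
have rA : (\rank A = \rank M + \rank M)%N.
  pose X : 'M[R]_(p + q, q + p) := block_mx 0 1%:M 1%:M 0.
  have XX : X *m block_mx 0 1%:M 1%:M 0 = 1%:M.
    rewrite mulmx_block !(mulmx0, mul0mx, addr0, add0r) !mulmx1.
    by rewrite -scalar_mx_block.
  have fX : row_free X by apply/row_freeP; eexists; exact: XX.
  rewrite -(mxrankMfree A fX) mulmx_block !(mulmx0, mul0mx, addr0, add0r) !mulmx1.
  by rewrite rank_diag_block_mx mxrank_tr.
by have := rank_ind symA; rewrite rA -indN !addnn => /double_inj.
Qed.

(** [T] is the orthogonal projector onto the kernel of [M]. The border clears everything in [D]
    except its compression to that kernel, which then splits off. *)
Lemma ind_bordered p q (M : 'M[R]_(p, q)) (D : 'M[R]_q) (T := 1%:M - M^† *m M) :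
  D^T = D -> ind (block_mx 0 M M^T D) = (\rank M + ind (T *m D *m T))%N.
Proof.
move=> symD; have /and4P[/eqP MGM /eqP GMG _ /eqP tGM] := mppinvP M.
pose Pi := M^† *m M; have PiE : M^† *m M = Pi by [].
have TE : T = 1%:M - Pi by [].
have tPi : Pi^T = Pi by [].
clearbody Pi T.
have tT : T^T = T by rewrite TE linearB /= trmx1 tPi.
have MPi : M *m Pi = M by rewrite -PiE mulmxA.
have MT : M *m T = 0 by rewrite TE mulmxBr mulmx1 MPi subrr.
have PiM : Pi *m M^T = M^T by rewrite -tPi -trmx_mul MPi.
have TM : T *m M^T = 0 by rewrite -tT -trmx_mul MT trmx0.
have PiPi : Pi *m Pi = Pi by rewrite -{1}PiE -mulmxA MPi.
have TPi : T *m Pi = 0 by rewrite TE mulmxBl mul1mx PiPi subrr.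
have TT : T *m T = T by rewrite {2}TE mulmxBr mulmx1 TPi subr0.
pose W := T *m D *m T; have WE : T *m D *m T = W by [].
have symW : W^T = W by rewrite !trmx_mul tT symD mulmxA.
(* [F] is chosen so that F M + (F M)^T = D - T D T; the factor 1/2 shares the symmetric term Pi D Pi
   between the two summands. *)
rewrite WE; pose F := (T *m D + 2^-1 *: (Pi *m D)) *m M^†.
have FM : F *m M = T *m D *m Pi + 2^-1 *: (Pi *m D *m Pi).
  by rewrite /F -mulmxA mulmxDl -scalemxAl PiE.
clearbody W F.
have defD : F *m M + (F *m M)^T + W = D.
  rewrite FM linearD /= linearZ /= !trmx_mul tPi tT symD !mulmxA.
  rewrite [X in X + _]addrACA -scalerDl.
  have -> : 2^-1 + 2^-1 = 1 :> R.
    by rewrite -mulr2n -[_ *+ 2]mulr_natr mulVf // pnatr_eq0.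
  rewrite scale1r -WE -[RHS]mul1mx -[RHS]mulmx1.
  have -> : 1%:M = Pi + T by rewrite TE addrC subrK.
  rewrite !mulmxDl !mulmxDr; set u := T *m D *m Pi; set v := Pi *m D *m T.
  set w := Pi *m D *m Pi; set t := T *m D *m T.
  by rewrite [RHS]addrACA [RHS]addrA [w + u]addrC [u + w + v]addrAC.
transitivity (ind (block_mx 0 M M^T W)).
  pose Q : 'M[R]_(p + q) := block_mx 1%:M 0 F 1%:M.
  apply: (@ind_congr_unit _ _ _ _ Q).
  - by apply: sym_block; rewrite ?trmx0.
  - by rewrite unitmxE det_lblock !det1 mulr1 unitr1.
  - rewrite tr_block_mx !trmx1 trmx0 !mulmx_block.
    rewrite !(mulmx0, mul0mx, addr0, add0r, mulmx1, mul1mx).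
    congr block_mx; rewrite -[LHS]defD -trmx_mul.
    by rewrite [F *m M + _]addrC -!addrA.
rewrite -(ind_offdiag M) -ind_block_diag ?sym_block ?trmx0 //.
(* The last q coordinates are doubled: their [Pi] part stays with the border, their [T] part goes to
   [W]. The sizes differ, hence the rectangular congruence. *)
apply: (@ind_congr _ _ _ _ _ (row_mx 1%:M (col_mx 0 1%:M))
                              (col_mx (block_mx 1%:M 0 0 Pi) (row_mx 0 T))).
- by apply: sym_block; rewrite ?trmx0.
- by apply: sym_block_diag => //; apply: sym_block; rewrite trmx0.
- rewrite tr_row_mx tr_col_mx !trmx1 trmx0 mul_row_block mul_row_col.
  rewrite !(mulmx0, mul0mx, addr0, add0r, mulmx1, mul1mx) mul_col_mx mul_col_row.
  by rewrite !(mulmx0, mul0mx, addr0, add0r, mulmx1, mul1mx) add_block_mx !(addr0, add0r).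
- have PiW : Pi *m W = 0.
    by rewrite -WE !mulmxA -[X in X *m D]trmxK trmx_mul tPi tT TPi trmx0 !mul0mx.
  have TW : T *m W = W by rewrite -WE !mulmxA TT.
  have WPi : W *m Pi = 0 by rewrite -[LHS]trmxK trmx_mul tPi symW PiW trmx0.
  have WT : W *m T = W by rewrite -[LHS]trmxK trmx_mul tT symW TW.
  rewrite tr_col_mx tr_row_mx tr_block_mx !trmx1 !trmx0 tPi tT.
  rewrite mul_col_mx mulmx_block mul_row_block.
  rewrite !(mulmx0, mul0mx, addr0, add0r, mulmx1, mul1mx) PiM PiW TM TW.
  rewrite mul_col_row mulmx_block mul_row_block mul_block_col mul_row_col.
  by rewrite !(mulmx0, mul0mx, addr0, add0r, mulmx1, mul1mx) MPi WPi MT WT row_mx0 col_mx0.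
Qed.

(** A Schur complement for singular [Z]: elimination by the generalised inverse [G] leaves the
    residual [F'] with G F' = 0, so [Z] and the residual border occupy complementary parts and their
    indices add. [C] and [W] say that [L] has the row space of [F']. *)
Lemma ind_schur a p l (Z G : 'M[R]_a) (F : 'M[R]_(a, p)) (D : 'M[R]_p)
    (L : 'M[R]_(l, p)) C W (F' := F - Z *m G *m F) :
    Z^T = Z -> G^T = G -> D^T = D -> Z *m G *m Z = Z -> G *m Z *m G = G ->
    F' = C *m L -> L = W *m F' ->
  ind (block_mx Z F F^T D)
    = (ind Z + ind (block_mx 0%R L L^T (D - F^T *m G *m F)))%N.
Proof.
move=> sZ sG sD ZGZ GZG defF' defL.
pose D' := D - F^T *m G *m F.
have sD' : D'^T = D' by rewrite linearB /= !trmx_mul trmxK sG sD mulmxA.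
have tF' : F'^T = F^T - F^T *m G *m Z.
  by rewrite linearB /= !trmx_mul sG sZ mulmxA.
have GF' : G *m F' = 0 by rewrite mulmxBr !mulmxA GZG subrr.
transitivity (ind (block_mx Z F' F'^T D')).
  pose Q : 'M[R]_(a + p) := block_mx 1%:M 0 (F^T *m G) 1%:M.
  apply: (@ind_congr_unit _ _ _ _ Q).
  - exact: sym_block.
  - by rewrite unitmxE det_lblock !det1 mulr1 unitr1.
  - rewrite tr_block_mx !trmx1 trmx0 trmx_mul trmxK sG !mulmx_block.
    rewrite !(mulmx0, mul0mx, addr0, add0r, mulmx1, mul1mx).
    rewrite -(mulmxA _ G F') GF' mulmx0 add0r tF' [_ + (F^T - _)]addrC subrK.
    by rewrite /F' /D' !mulmxA [_ + (F - _)]addrC subrK [_ + (D - _)]addrC subrK.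
have ZGF : Z *m G *m F' = 0 by rewrite -mulmxA GF' mulmx0.
rewrite -/D'; clearbody F' D'.
rewrite -ind_block_diag ?sym_block ?trmx0 //.
(* The projectors Z G and 1 - Z G send the first coordinates to [Z] and to the border; [W] and [C]
   translate between [F'] and [L]. *)
pose P : 'M[R]_(a + p, a + (l + p)) := block_mx 1%:M (row_mx C 0) 0 (row_mx 0 1%:M).
pose Q : 'M[R]_(a + (l + p), a + p) :=
  col_mx (row_mx (Z *m G) 0) (block_mx (W *m (1%:M - Z *m G)) 0 0 1%:M).
apply: (@ind_congr _ _ _ _ _ P Q).
- exact: sym_block.
- by apply: sym_block_diag => //; apply: sym_block; rewrite ?trmx0.
- rewrite /P tr_block_mx !tr_row_mx !trmx1 !trmx0 !mulmx_block.
  rewrite !(mulmx0, mul0mx, addr0, add0r, mulmx1, mul1mx).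
  rewrite !mul_row_block !mul_row_col.
  rewrite !(mulmx0, mul0mx, addr0, add0r, mulmx1, mul1mx).
  by rewrite -trmx_mul defF'.
- have tQ : Q^T = row_mx (col_mx (G *m Z) 0) (block_mx ((1%:M - G *m Z) *m W^T) 0 0 1%:M).
    rewrite tr_col_mx tr_row_mx tr_block_mx !trmx_mul !trmx0 trmx1 linearB /=.
    by rewrite trmx1 trmx_mul sZ sG.
  have F'G : F'^T *m (G *m Z) = 0.
    by rewrite mulmxA -[F'^T *m G]trmxK trmx_mul trmxK sG GF' trmx0 mul0mx.
  have ZGZ' : Z *m (G *m Z) = Z by rewrite mulmxA.
  have Z1 : (1%:M - Z *m G) *m Z = 0 by rewrite mulmxBl mul1mx ZGZ subrr.
  have Z1' : Z *m (1%:M - G *m Z) = 0 by rewrite mulmxBr mulmx1 ZGZ' subrr.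
  have WF : W *m (1%:M - Z *m G) *m F' = L.
    by rewrite -mulmxA mulmxBl mul1mx ZGF subr0 -defL.
  have FW : F'^T *m ((1%:M - G *m Z) *m W^T) = L^T.
    by rewrite mulmxA mulmxBr mulmx1 F'G subr0 -trmx_mul defL.
  rewrite tQ /Q mul_col_mx mulmx_block mul_row_block.
  rewrite !(mulmx0, mul0mx, addr0, add0r, mulmx1, mul1mx) ZGZ ZGF WF.
  rewrite -(mulmxA W) Z1 mulmx0 mul_col_row.
  rewrite mulmx_block mul_row_block mul_block_col mul_row_col.
  rewrite !(mulmx0, mul0mx, addr0, add0r, mulmx1, mul1mx) ZGZ' F'G FW.
  by rewrite mulmxA Z1' mul0mx col_mx0 row_mx0.
Qed.

(* The Schur complement with respect to a block with two zero corners, whose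
   pseudoinverse is again off-diagonal. *)
Lemma ind_schur_offdiag n p (E : 'M[R]_n) (K N : 'M[R]_(n, p)) (D : 'M[R]_p) C
    (L := (1%:M - E^† *m E) *m N) :
    D^T = D -> (1%:M - E *m E^†) *m K = C *m L ->
  ind (block_mx (block_mx 0 E E^T 0) (col_mx K N) (col_mx K N)^T D)
    = (\rank E
       + ind (block_mx 0%R L L^T (D - K^T *m E^†^T *m N - N^T *m E^† *m K)))%N.
Proof.
move=> sD defK; have /and4P[/eqP EGE /eqP GEG /eqP tEG /eqP tGE] := mppinvP E.
have tEG' : E^†^T *m E^T = E *m E^† by rewrite -trmx_mul.
have tGE' : E^T *m E^†^T = E^† *m E by rewrite -trmx_mul.
pose Z : 'M[R]_(n + n) := block_mx 0 E E^T 0.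
pose G : 'M[R]_(n + n) := block_mx 0 E^†^T E^† 0.
have ZG : Z *m G = block_mx (E *m E^†) 0 0 (E^† *m E).
  by rewrite mulmx_block !(mulmx0, mul0mx, addr0, add0r) tGE'.
have FE : col_mx K N - Z *m G *m col_mx K N = col_mx C 1%:M *m L.
  rewrite ZG mul_block_col !(mulmx0, mul0mx, addr0, add0r) mul_col_mx mul1mx -defK.
  by rewrite opp_col_mx add_col_mx /L !mulmxBl !mul1mx.
have sZ : Z^T = Z by apply: sym_block; rewrite trmx0.
have sG : G^T = G by rewrite tr_block_mx !trmx0 trmxK.
have ZGZ : Z *m G *m Z = Z.
  rewrite ZG mulmx_block !(mulmx0, mul0mx, addr0, add0r) EGE -tGE'.
  by rewrite -!trmx_mul mulmxA EGE.
have GZG : G *m Z *m G = G.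
  rewrite -mulmxA ZG mulmx_block !(mulmx0, mul0mx, addr0, add0r) mulmxA GEG.
  by rewrite -tGE' -!trmx_mul GEG.
have LE : L = row_mx 0 1%:M *m (col_mx K N - Z *m G *m col_mx K N).
  by rewrite FE mulmxA mul_row_col mul0mx add0r !mul1mx.
rewrite (ind_schur sZ sG sD ZGZ GZG FE LE) ind_offdiag; congr (_ + ind _)%N.
rewrite tr_col_mx mul_row_block !(mulmx0, mul0mx, addr0, add0r).
by rewrite mul_row_col opprD addrA addrAC.
Qed.


(** Only the row space of the border matters, so it may change by a sign or by any matrix with the
    same row space. *)
Lemma ind_border_eqmx a b p (L : 'M[R]_(a, p)) (L' : 'M[R]_(b, p)) D C C' :
    D^T = D -> L = C *m L' -> L' = C' *m L ->
  ind (block_mx 0 L L^T D) = ind (block_mx 0 L' L'^T D).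
Proof.
move=> sD defL defL'.
apply: (@ind_congr _ _ _ _ _ (block_mx C 0 0 1%:M) (block_mx C' 0 0 1%:M)).
- by apply: sym_block; rewrite ?trmx0.
- by apply: sym_block; rewrite ?trmx0.
- rewrite tr_block_mx !trmx0 trmx1 !mulmx_block.
  by rewrite !(mulmx0, mul0mx, addr0, add0r, mulmx1, mul1mx) -trmx_mul -defL.
- rewrite tr_block_mx !trmx0 trmx1 !mulmx_block.
  by rewrite !(mulmx0, mul0mx, addr0, add0r, mulmx1, mul1mx) -trmx_mul -defL'.
Qed.

(** The hypothesis makes the stack of [a] and [c] an isometry, which regroups coordinates without a
    cast between [p] and [k + q]. *)
Lemma ind_split p k q (Z : 'M[R]_p) (a : 'M[R]_(k, p)) (c : 'M[R]_(q, p)) :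
    Z^T = Z -> a^T *m a + c^T *m c = 1%:M ->
  ind Z = ind (block_mx (a *m Z *m a^T) (a *m Z *m c^T)
                        (a *m Z *m c^T)^T (c *m Z *m c^T)).
Proof.
move=> sZ ac; set B := block_mx _ _ _ _.
have defB : B = col_mx a c *m Z *m (col_mx a c)^T.
  rewrite tr_col_mx mul_col_mx mul_col_row; congr block_mx.
  by rewrite !trmx_mul trmxK sZ mulmxA.
apply: (@ind_congr _ _ _ _ _ (col_mx a c)^T (col_mx a c)) => //.
  by rewrite defB !trmx_mul trmxK sZ mulmxA.
have acac : (col_mx a c)^T *m col_mx a c = 1%:M by rewrite tr_col_mx mul_row_col.
by rewrite trmxK defB !mulmxA acac mul1mx -mulmxA acac mulmx1.
Qed.

End Blocks.

(** * Lagrangian frames *)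

Section Lagrangian.
Variables (R : rcfType) (n : nat).
Implicit Types (Y V W : 'M[R]_(n + n, n)).

Lemma mppinv_unique p q (A : 'M[R]_(p, q)) B : penrose A B -> A^† = B.
Proof. exact: penrose_uniq (mppinvP A). Qed.

Lemma mppinv_tr p q (A : 'M[R]_(p, q)) : A^T^† = A^†^T.
Proof.
have /and4P[/eqP a /eqP b /eqP c /eqP d] := mppinvP A.
apply/mppinv_unique/and4P; rewrite -!trmx_mul !mulmxA a b !trmxK c d.
by split.
Qed.

(** For s = 1 or -1, where s is its own inverse, so that later both signs are treated at once. *)
Lemma mppinv_sign p q (A : 'M[R]_(p, q)) (s : R) : s * s = 1 ->
  (s *: A)^† = s *: A^†.
Proof.
move=> ss; have /and4P[/eqP a /eqP b /eqP c /eqP d] := mppinvP A.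
have AB : s *: A *m (s *: A^†) = A *m A^†.
  by rewrite -scalemxAl -scalemxAr scalerA ss scale1r.
have BA : s *: A^† *m (s *: A) = A^† *m A.
  by rewrite -scalemxAl -scalemxAr scalerA ss scale1r.
by apply/mppinv_unique/and4P; split; rewrite ?AB ?BA -?scalemxAr ?a ?b ?c ?d.
Qed.

Lemma mppinvN p q (A : 'M[R]_(p, q)) : (- A)^† = - A^†.
Proof. by rewrite -scaleN1r mppinv_sign ?scaleN1r // mulrNN mulr1. Qed.

Lemma Jmx_tr : (Jmx : 'M[R]_(n + n))^T = - Jmx.
Proof.
by rewrite /Jmx tr_block_mx opp_block_mx linearN /= !trmx0 trmx1 !oppr0 opprK.
Qed.

Lemma wronskianT Y V : (wronskian Y V)^T = - wronskian V Y.
Proof. by rewrite /wronskian !trmx_mul trmxK Jmx_tr mulNmx mulmxN mulmxA. Qed.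

Lemma wronskian_symplectic (S : 'M[R]_(n + n)) Y V : symplectic S ->
  wronskian (S *m Y) (S *m V) = wronskian Y V.
Proof. by rewrite /symplectic /wronskian trmx_mul => {2}<-; rewrite !mulmxA. Qed.

Lemma wronskianE Y V :
  wronskian Y V = (usubmx Y)^T *m dsubmx V - (dsubmx Y)^T *m usubmx V.
Proof.
rewrite /wronskian -{1}[Y]vsubmxK -{1}[V]vsubmxK tr_col_mx mul_row_block.
by rewrite mul_row_col !(mulmx0, mulmx1, mulmxN, add0r, addr0) mulNmx addrC.
Qed.

Lemma bframe_wronskian p (W : 'M[R]_(n + n, p)) :
  bframe^T *m Jmx *m W = - usubmx W.
Proof.
rewrite -[W in LHS]vsubmxK tr_col_mx mul_row_block mul_row_col.
by rewrite trmx0 trmx1 !(mul0mx, mulmx0, mul1mx, mulmxN, addr0, add0r) mulNmx mul1mx.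
Qed.

Lemma frame_bframe : frame (bframe : 'M[R]_(n + n, n)).
Proof.
split; first by rewrite wronskianE !col_mxKu !col_mxKd trmx0 mul0mx mulmx0 subrr.
by rewrite rank_col_0mx mxrank1.
Qed.

(** A Lagrangian subspace is its own symplectic complement: one inclusion is isotropy, and both
    sides have dimension n. *)
Lemma frame_orth p V (u : 'M[R]_(p, n + n)) : frame V ->
  u *m Jmx *m V = 0 -> exists q, u = q *m V^T.
Proof.
move=> [VV rV] uV; apply/submxP.
have JV : \rank (Jmx *m V) = n.
  have JJ : Jmx *m (- Jmx) = 1%:M :> 'M[R]_(n + n).
    rewrite opp_block_mx mulmx_block !(oppr0, opprK, mulmx0, mul0mx, add0r, addr0).
    by rewrite !mulmxN !mulmx1 opprK -scalar_mx_block.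
  rewrite (eqmxMfull _ (_ : row_full Jmx)) // row_full_unit.
  by case: (mulmx1_unit JJ).
have sub1 : (V^T <= kermx (Jmx *m V))%MS by apply/sub_kermxP; rewrite mulmxA.
have sub2 : (u <= kermx (Jmx *m V))%MS by apply/sub_kermxP; rewrite mulmxA.
apply: submx_trans sub2 _; have [_ <-] := mxrank_leqif_sup sub1.
by rewrite mxrank_ker mxrank_tr JV rV addnK.
Qed.

(* The left kernel of w(V0, V1) parametrizes the intersection of the two
   Lagrangian subspaces, and so does the right kernel. *)
Lemma frame_transfer V0 V1 (E := wronskian V0 V1) : frame V0 -> frame V1 ->
  exists C, forall p (W : 'M[R]_(n + n, p)),
    (1%:M - E *m E^†) *m (V0^T *m Jmx *m W)
      = C *m ((1%:M - E^† *m E) *m (V1^T *m Jmx *m W)).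
Proof.
move=> F0 F1; have /and4P[/eqP EGE /eqP GEG /eqP tEG /eqP tGE] := mppinvP E.
pose U := 1%:M - E *m E^†.
have UE : U *m V0^T *m Jmx *m V1 = 0.
  rewrite -!mulmxA [V0^T *m _]mulmxA -/(wronskian V0 V1) -/E.
  by rewrite mulmxBl mul1mx EGE subrr.
have [q defq] := frame_orth F1 UE.
(* Up to sign q E^T is U V0^T J V0, which vanishes because V0 is isotropic. *)
have qEE : q *m (E^† *m E) = 0.
  rewrite -tGE trmx_mul mulmxA wronskianT mulmxN /wronskian !mulmxA -defq.
  by rewrite -!mulmxA [V0^T *m _]mulmxA -/(wronskian V0 V0) F0.1 mulmx0 oppr0 mul0mx.
exists q => p W; rewrite -/U [RHS]mulmxA mulmxBr mulmx1 qEE subr0.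
by rewrite !mulmxA defq.
Qed.

(** As X^T U is symmetric, kernel vectors of the pencil for different t have orthogonal images under
    X, nonzero because Y has rank n. If t = 0, ..., n all failed, there would be n + 1 nonzero
    orthogonal vectors in dimension n. *)
Lemma frame_pencil Y : frame Y ->
  exists t : R, t *: usubmx Y - dsubmx Y \in unitmx.
Proof.
move=> [YY rY]; set X := usubmx Y; set U := dsubmx Y.
have XU : X^T *m U = U^T *m X.
  by apply/eqP; rewrite -subr_eq0 -wronskianE YY.
suff /existsP[k uk] : [exists k : 'I_n.+1, (val k)%:R *: X - U \in unitmx].
  by exists k%:R.
apply: contraT; rewrite negb_exists => /forallP nu.
pose M (k : 'I_n.+1) := (k%:R *: X - U)^T.
pose c k := nz_row (kermx (M k)).
have c0 k : c k != 0.
  rewrite nz_row_eq0 kermx_eq0 row_free_unit unitmx_tr; exact: nu.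
have cU k : c k *m U^T = k%:R *: (c k *m X^T).
  have /sub_kermxP : (c k <= kermx (M k))%MS by exact: nz_row_sub.
  rewrite /M linearB linearZ /= mulmxBr -scalemxAr => /eqP.
  by rewrite subr_eq0 => /eqP ->.
have orth k l : k != l -> c k *m X^T *m (c l *m X^T)^T = 0.
  move=> kl; have : c k *m X^T *m (c l *m U^T)^T = c k *m U^T *m (c l *m X^T)^T.
    by rewrite !trmx_mul !trmxK !mulmxA -(mulmxA _ X^T) XU mulmxA.
  rewrite !cU linearZ /= -scalemxAr -scalemxAl => /eqP.
  rewrite -subr_eq0 -scalerBl scaler_eq0 subr_eq0 eqr_nat eq_sym => /orP[|/eqP//].
  by rewrite (inj_eq val_inj) (negPf kl).
have pos k : qf 1%:M (c k *m X^T) != 0.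
  rewrite qf1_eq0; apply: contra (c0 k) => /eqP cX.
  have cY : c k *m Y^T = 0.
    by rewrite -[Y]vsubmxK tr_col_mx mul_mx_row -/X -/U cU cX scaler0 row_mx0.
  have fY : row_free Y^T by rewrite /row_free mxrank_tr rY.
  by rewrite -(mulmx_free_eq0 _ fY) cY.
pose B := \matrix_k (c k *m X^T).
have : row_free B.
  apply: inj_row_free => v vB; apply/rowP => k; rewrite [RHS]mxE.
  have : v *m B *m (c k *m X^T)^T = 0 by rewrite vB mul0mx.
  rewrite [v *m B]mulmx_sum_row mulmx_suml (bigD1 k) //= big1 ?addr0.
    rewrite rowK -scalemxAl => /matrixP/(_ 0 0); rewrite mxE [RHS]mxE => /eqP.
    by rewrite mulf_eq0; have := pos k; rewrite /qf mulmx1 => /negPf -> /orP[/eqP|].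
  by move=> l lk; rewrite rowK -scalemxAl orth ?scaler0.
by rewrite /row_free => /eqP rB; have := rank_leq_col B; rewrite rB ltnn.
Qed.

(** Each determinant is a nonzero polynomial in t, so the finite product of them has a non-root. *)
Lemma common_pencil m (V : nat -> 'M[R]_(n + n, n)) :
    (forall i, (i <= m)%N -> frame (V i)) ->
  exists t : R, forall i, (i <= m)%N -> t *: usubmx (V i) - dsubmx (V i) \in unitmx.
Proof.
move=> FV; pose p i : {poly R} :=
  \det ('X *: map_mx polyC (usubmx (V i)) - map_mx polyC (dsubmx (V i))).
have pE i t : (p i).[t] = \det (t *: usubmx (V i) - dsubmx (V i)).
  rewrite -horner_evalE -det_map_mx; congr (\det _); apply/matrixP => k l.
  by rewrite [LHS]mxE -[LHS]/(_.[t]) !mxE !hornerE.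
have p0 i : (i <= m)%N -> p i != 0.
  move=> /FV/frame_pencil[t]; rewrite unitmxE unitfE -pE.
  by apply: contraNneq => ->; rewrite horner0.
pose q := \prod_(i < m.+1) p i.
have q0 : q != 0 by apply/prodf_neq0 => i _; apply: p0; rewrite -ltnS.
have [t qt] : exists t, ~~ root q t.
  pose s : seq R := [seq k%:R | k <- iota 0 (size q)].
  have us : uniq s by rewrite map_inj_uniq ?iota_uniq //; by move=> a b /eqP; rewrite eqr_nat => /eqP.
  have: ~~ all (root q) s.
    apply/negP => rs; have := max_poly_roots q0 rs us.
    by rewrite size_map size_iota ltnn.
  by move=> /allPn[t _ qt]; exists t.
exists t => i im; rewrite unitmxE unitfE -pE.
apply: contra qt; rewrite rootE horner_prod => /eqP pit.
have im' : (i < m.+1)%N by [].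
by rewrite (bigD1 (Ordinal im')) //= pit mul0r.
Qed.

(* Taking {(x, t x)} as the vertical Lagrangian subspace turns every frame into
   the graph of a symmetric matrix, and w(V i, V j) into a difference. *)
Lemma frames_graph m (V : nat -> 'M[R]_(n + n, n)) :
    (forall i, (i <= m)%N -> frame (V i)) ->
  exists A G : nat -> 'M[R]_n,
    [/\ forall i, (i <= m)%N -> (A i)^T = A i,
        forall i, (i <= m)%N -> G i \in unitmx
      & forall i j, (i <= m)%N -> (j <= m)%N ->
          wronskian (V i) (V j) = (G i)^T *m (A j - A i) *m G j].
Proof.
move=> FV; have [t ut] := common_pencil FV.
pose G i := t *: usubmx (V i) - dsubmx (V i).
pose A i := usubmx (V i) *m invmx (G i).
have AG i : (i <= m)%N -> A i *m G i = usubmx (V i).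
  by move=> im; rewrite mulmxKV // ut.
(* The terms in t cancel: shifting the lower block by t X is symplectic. *)
have wE i j : wronskian (V i) (V j) =
    (G i)^T *m usubmx (V j) - (usubmx (V i))^T *m G j.
  rewrite wronskianE /G linearB linearZ /= mulmxBl mulmxBr -scalemxAl -scalemxAr.
  by rewrite opprB [RHS]addrC addrA subrK.
have symA i : (i <= m)%N -> (A i)^T = A i.
  move=> im; have /eqP := wE i i; rewrite (FV i im).1 eq_sym subr_eq0 => /eqP e.
  have uG := ut i im; have uGT : (G i)^T \in unitmx by rewrite unitmx_tr.
  rewrite /A trmx_mul trmx_inv; apply: (can_inj (mulKmx uGT)).
  by rewrite mulKVmx // mulmxA e mulmxK.
have uG i : (i <= m)%N -> G i \in unitmx by exact: ut.
clearbody A G; exists A, G; split=> // i j im jm; rewrite wE -(AG i im) -(AG j jm).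
by rewrite trmx_mul symA // mulmxBr mulmxBl !mulmxA.
Qed.

End Lagrangian.

(** * The cyclic congruence *)

Section Cyclic.
Variables (R : rcfType) (n : nat).

Lemma mxblockZ p q (p_ : 'I_p -> nat) (q_ : 'I_q -> nat) (c : R)
    (B : forall i j, 'M[R]_(p_ i, q_ j)) :
  c *: \mxblock_(i < p, j < q) B i j = \mxblock_(i < p, j < q) (c *: B i j).
Proof. by apply/matrixP => i j; rewrite !mxE. Qed.

(** The upper triangle is reflected because Wronskians satisfy w(j, i) = -w(i, j)^T: the full array
    of them would be skew-symmetric. *)
Definition upper_sym (w : nat -> nat -> 'M[R]_n) m :
    'M[R]_(\sum_(i < m) n, \sum_(j < m) n) :=
  \mxblock_(i < m, j < m) (if (i <= j)%N then w i j else (w j i)^T).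

Lemma upper_sym_tr (w : nat -> nat -> 'M[R]_n) m :
  (forall i, (i < m)%N -> (w i i)^T = w i i) -> (upper_sym w m)^T = upper_sym w m.
Proof.
move=> sw; rewrite tr_mxblock; apply: eq_mxblock => i j.
case: ltngtP => [ij|ij|/val_inj->]; rewrite ?trmxK //.
by rewrite sw // ltn_ord.
Qed.

Section Graphs.
Variables (m : nat) (A G : nat -> 'M[R]_n).
Hypothesis symA : forall i, (i <= m)%N -> (A i)^T = A i.
Hypothesis unitG : forall i, (i <= m)%N -> G i \in unitmx.

Let w i j := (G i)^T *m (A j - A i) *m G j.
Let T := upper_sym w m.+1.
Let D (j : 'I_m.+1) := (if (j < m)%N then A j.+1 else A 0%N) - A j.
(** For i <= k, the product of [eps i j] and [eps k j] is -1 exactly when i <= j < k. *)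
Let eps (i j : nat) : R := if (i <= j)%N then 1 else -1.
Let P : 'M[R]_(\sum_(i < m.+1) n, \sum_(j < m.+1) n) :=
  \mxblock_(i < m.+1, j < m.+1) (eps i j *: (G i)^T).

Lemma cyclic_sum (B : nat -> 'M[R]_n) :
  \sum_(j < m.+1) ((if (j < m)%N then B j.+1 else B 0%N) - B j) = 0.
Proof.
rewrite big_ord_recr /= ltnn.
under eq_bigr => j _ do rewrite ltn_ord.
rewrite -(big_mkord xpredT (fun j => B j.+1 - B j)) telescope_sumr //.
by rewrite addrC addrA subrK subrr.
Qed.

(** All [D j] sum to 0 around the cycle, so the signed sum is minus twice the sum over i <= j < k,
    which telescopes. *)
Lemma eps_sum (i k : nat) : (i <= k <= m)%N ->
  \sum_(j < m.+1) (eps i j * eps k j) *: D j = - (2 *: (A k - A i)).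
Proof.
move=> /andP[ik km].
have -> : \sum_(j < m.+1) (eps i j * eps k j) *: D j =
    \sum_(j < m.+1) D j - \sum_(j < m.+1) 2 *: (if (i <= j < k)%N then D j else 0).
  rewrite -sumrB; apply: eq_bigr => j _; rewrite /eps; move: (D j) => d.
  case: (leqP i j) => ij; case: (leqP k j) => kj /=.
  - by rewrite mulr1 scale1r scaler0 subr0.
  - by rewrite mul1r scaleN1r scaler_nat mulr2n opprD addrA subrr sub0r.
  - by have := leq_trans ik kj; rewrite leqNgt ij.
  - by rewrite mulrNN mulr1 scale1r scaler0 subr0.
rewrite cyclic_sum sub0r -scaler_sumr; congr (- (_ *: _)).
rewrite -(telescope_sumr _ ik) (big_nat_widenl _ 0) // (big_nat_widen _ _ m.+1) ?leqW //.
rewrite big_mkord [RHS]big_mkcond /=; apply: eq_bigr => j _.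
by case: ifP => // /andP[ij jk]; rewrite /D (leq_trans jk).
Qed.

Lemma cyclic_congr : P *m (\mxdiag_j D j) *m P^T = - (2 *: T).
Proof.
rewrite mul_mxblock_mxdiag tr_mxblock mul_mxblock.
rewrite -scaleNr [T]/(upper_sym _ _) /upper_sym mxblockZ.
apply: eq_mxblock => i k.
transitivity ((G i)^T *m (\sum_(j < m.+1) (eps i j * eps k j) *: D j) *m G k).
  rewrite mulmx_sumr mulmx_suml; apply: eq_bigr => j _.
  rewrite linearZ /= trmxK -scalemxAl -!scalemxAr -!scalemxAl scalerA.
  by rewrite mulrC.
have im : (i <= m)%N by rewrite -ltnS.
have km : (k <= m)%N by rewrite -ltnS.
case: (leqP i k) => ik.
  by rewrite eps_sum ?ik // mulmxN mulNmx -scalemxAr -scalemxAl scaleNr.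
under eq_bigr do rewrite mulrC.
rewrite eps_sum ?im ?(ltnW ik) // mulmxN mulNmx -scalemxAr -scalemxAl scaleNr.
congr (- (2 *: _)).
by rewrite /w !trmx_mul trmxK [(A i - A k)^T]linearB /= !symA // mulmxA.
Qed.

(** Sign columns j - 1 and j differ only in row j, so their difference isolates that row. *)
Lemma cyclic_unit : P \in unitmx.
Proof.
rewrite -row_free_unit; apply: inj_row_free => x xP.
pose z (i : 'I_m.+1) := submxrow x i *m (G i)^T.
have f0 (j : 'I_m.+1) : \sum_(i < m.+1) eps i j *: z i = 0.
  have : submxrow (x *m P) j = 0 by rewrite xP submxrow0.
  rewrite -{1}[x]submxrowK mul_mxrow_mxblock mxrowK => xPj.
  by rewrite -[RHS]xPj; apply: eq_bigr => i _; rewrite -scalemxAr.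
have epsS (j k : 'I_m.+1) (c : R) :
    (forall i : 'I_m.+1, eps i j + c * eps i k = (i == j)%:R * 2) -> z j = 0.
  move=> ec; have : \sum_(i < m.+1) (eps i j + c * eps i k) *: z i = 0.
    under eq_bigr do rewrite scalerDl -scalerA.
    by rewrite big_split /= -scaler_sumr !f0 scaler0 addr0.
  rewrite (bigD1 j) //= big1 ?addr0 => [|i ij]; rewrite ec; last first.
    by rewrite (negPf ij) mul0r scale0r.
  by rewrite eqxx mul1r => /eqP; rewrite scaler_eq0 pnatr_eq0 => /eqP.
have z0 j : z j = 0.
  have [j0|j0] := posnP j.
    (* Column 0 has no predecessor; adding the last column, whose signs are all 1, isolates row
       0. *)
    apply: (epsS j ord_max 1) => i; have im : (i <= m)%N by rewrite -ltnS.
    rewrite /eps j0 /= im leqn0 mulr1.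
    rewrite -val_eqE /= j0; case: eqP => _; rewrite ?mul1r ?mul0r //.
    by rewrite addrC subrr.
  have jm : (j.-1 < m.+1)%N by rewrite prednK // ltnW.
  apply: (epsS j (Ordinal jm) (-1)) => i; rewrite /eps /= mulN1r.
  have -> : (i <= j.-1)%N = (i < j)%N by rewrite -ltnS prednK.
  rewrite -val_eqE /=; case: ltngtP => _; rewrite ?opprK ?mul1r ?mul0r //.
  - exact: subrr.
  - by rewrite addrC subrr.
rewrite -[x]submxrowK -[RHS]submxrowK; apply/eq_mxrow => j; rewrite submxrow0.
have jm : (j <= m)%N by rewrite -ltnS.
have uGT : (G j)^T \in unitmx by rewrite unitmx_tr unitG.
by rewrite -[submxrow x j](mulmxK uGT) -/(z j) z0 mul0mx.
Qed.

Let symD j : (D j)^T = D j.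
Proof.
have jm : (j <= m)%N by rewrite -ltnS.
by rewrite /D linearB /=; case: ifP => ?; rewrite !symA.
Qed.

Let symDD : (\mxdiag_j D j)^T = \mxdiag_j D j.
Proof. by rewrite tr_mxdiag; apply: eq_mxdiag. Qed.

Let symT : T^T = T.
Proof.
apply: upper_sym_tr => i im.
by rewrite /w !trmx_mul trmxK linearB /= !subrr mulmx0 !mul0mx mulmx0.
Qed.

(* Both index formulas come from the congruence of -2T with
   diag(A 1 - A 0, ..., A m - A (m - 1), A 0 - A m). *)
Lemma ind_cyclicN :
  ind (- T) = (\sum_(j < m) ind (A j.+1 - A j) + ind (A 0 - A m))%N.
Proof.
have symNT : (- T)^T = - T by rewrite linearN /= symT.
rewrite -(ind_scale symNT (ltr0n _ 2)).
rewrite (ind_congr_unit (P := P) (B := \mxdiag_j D j)) ?cyclic_unit //; last first.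
  by rewrite cyclic_congr scalerN.
rewrite ind_mxdiag // big_ord_recr /= /D ltnn; congr (_ + _)%N.
by apply: eq_bigr => j _ /=; rewrite ltn_ord.
Qed.

Lemma ind_cyclic :
  ind T = (\sum_(j < m) ind (A j - A j.+1) + ind (A m - A 0))%N.
Proof.
rewrite -(ind_scale symT (ltr0n _ 2)).
rewrite (ind_congr_unit (P := P) (B := \mxdiag_j - D j)) ?cyclic_unit //.
- rewrite ind_mxdiag => [|j]; last by rewrite linearN /= symD.
  rewrite big_ord_recr /= /D ltnn opprB; congr (_ + _)%N.
  by apply: eq_bigr => j _ /=; rewrite ltn_ord opprB.
- by rewrite mxdiagN linearN /= symDD.
- by rewrite mxdiagN mulmxN mulNmx cyclic_congr opprK.
Qed.

End Graphs.

(** A block row of the identity; a natural number as index spares the ordinals for rows 0, i + 1 and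
    N + 1. *)
Definition blk_row m (k : nat) : 'M[R]_(n, \sum_(j < m) n) :=
  \mxrow_(j < m) ((k == j)%:R)%:M.

Lemma mul_blk_row_tr m p (F : 'I_m -> 'M[R]_(p, n)) (j : 'I_m) :
  \mxrow_(j < m) F j *m (blk_row m j)^T = F j.
Proof.
rewrite tr_mxrow mul_mxrow_mxcol (bigD1 j) //= eqxx tr_scalar_mx mulmx1.
rewrite big1 ?addr0 // => k kj.
by rewrite eq_sym val_eqE (negPf kj) tr_scalar_mx mul_mx_scalar scale0r.
Qed.

Lemma mul_blk_row m (B : 'I_m -> 'I_m -> 'M[R]_n) (i : 'I_m) :
  blk_row m i *m (\mxblock_(i < m, j < m) B i j) = \mxrow_(j < m) B i j.
Proof.
rewrite mul_mxrow_mxblock; apply: eq_mxrow => j.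
rewrite (bigD1 i) //= eqxx mul1mx big1 ?addr0 // => k ki.
by rewrite eq_sym val_eqE (negPf ki) mul_scalar_mx scale0r.
Qed.

Lemma blk_row_complete m :
  \sum_(k < m) (blk_row m k)^T *m blk_row m k = 1%:M.
Proof.
pose I : 'M[R]_(\sum_(j < m) n) := \mxcol_(k < m) blk_row m k.
have I1 : I = 1%:M.
  rewrite /I /blk_row -mxblockEv -mxdiagZ; apply: eq_mxblock => i j.
  case: (eqVneq i j) => [->|ij]; first by rewrite eqxx conform_mx_id.
  by rewrite val_eqE (negPf ij) -scalemx1 scale0r.
by rewrite -[1%:M]mulmx1 -{1}trmx1 -I1 tr_mxcol mul_mxrow_mxcol.
Qed.

End Cyclic.

(** * The comparative index *)

Section ComparativeIndex.
Variables (R : rcfType) (n : nat).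

Lemma eq_upper_sym (w w' : nat -> nat -> 'M[R]_n) m :
    (forall i j, (i < m)%N -> (j < m)%N -> w i j = w' i j) ->
  upper_sym w m = upper_sym w' m.
Proof. by move=> ww; apply: eq_mxblock => i j; rewrite !ww. Qed.

(** Brings the first and last block rows to the front, so that this pair can be eliminated; its
    diagonal blocks vanish. The factor [s] covers the matrix and its negative. *)
Lemma ind_outer (w : nat -> nat -> 'M[R]_n) N q
    (c : 'M[R]_(q, \sum_(j < N.+2) n)) (s : R)
    (T := upper_sym w N.+2) (r0 := blk_row R n N.+2 0) (r1 := blk_row R n N.+2 N.+1)
    (E := s *: w 0%N N.+1) (F := col_mx (s *: (r0 *m T *m c^T)) (s *: (r1 *m T *m c^T))) :
    (forall i, w i i = 0) -> r0^T *m r0 + r1^T *m r1 + c^T *m c = 1%:M ->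
  ind (s *: T) = ind (block_mx (block_mx 0 E E^T 0) F F^T (s *: (c *m T *m c^T))).
Proof.
move=> w0 rc; have symT : (s *: T)^T = s *: T.
  by rewrite linearZ /= upper_sym_tr // => i _; rewrite w0 trmx0.
have rT (i j : 'I_N.+2) : blk_row R n N.+2 i *m T *m (blk_row R n N.+2 j)^T =
    if (i <= j)%N then w i j else (w j i)^T.
  by rewrite mul_blk_row mul_blk_row_tr.
have := rT ord0 ord0; have := rT ord0 ord_max; have := rT ord_max ord0.
have := rT ord_max ord_max; rewrite /= -/r0 -/r1 leqnn !w0 => e11 e10 e01 e00.
clear rT; clearbody T r0 r1.
have b1 : col_mx r0 r1 *m (s *: T) *m (col_mx r0 r1)^T = block_mx 0 E E^T 0.
  rewrite -scalemxAr -scalemxAl tr_col_mx mul_col_mx mul_col_row e00 e01 e10 e11.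
  by rewrite scale_block_mx !scaler0 /E linearZ.
have b2 : col_mx r0 r1 *m (s *: T) *m c^T = F.
  by rewrite -scalemxAr -scalemxAl !mul_col_mx scale_col_mx.
have b3 : c *m (s *: T) *m c^T = s *: (c *m T *m c^T).
  by rewrite -scalemxAr -scalemxAl.
have cplt : (col_mx r0 r1)^T *m col_mx r0 r1 + c^T *m c = 1%:M.
  by rewrite tr_col_mx mul_row_col.
by rewrite (ind_split symT cplt) b1 b2 b3.
Qed.

Lemma wronskian_sub (Y Yh : 'M[R]_(n + n, n)) (Q T : 'M[R]_n) :
    frame Y -> frame Yh ->
  wronskian (Y *m Q - Yh *m T) (Y *m Q - Yh *m T) =
    T^T *m (wronskian Y Yh)^T *m Q - Q^T *m wronskian Y Yh *m T.
Proof.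
move=> [YY _] [YhYh _]; rewrite wronskianT /wronskian.
rewrite [(_ - _)^T]linearB /= !trmx_mul !mulmxBl !mulmxBr.
have -> : Q^T *m Y^T *m Jmx *m (Y *m Q) = Q^T *m wronskian Y Y *m Q.
  by rewrite /wronskian !mulmxA.
have -> : T^T *m Yh^T *m Jmx *m (Yh *m T) = T^T *m wronskian Yh Yh *m T.
  by rewrite /wronskian !mulmxA.
by rewrite YY YhYh !mulmx0 !mul0mx subr0 sub0r mulmxN mulNmx !mulmxA addrC.
Qed.

Section Pair.
Variables Y Yh : 'M[R]_(n + n, n).
Hypotheses (FY : frame Y) (FYh : frame Yh).
Let X := usubmx Y.
Let Xh := usubmx Yh.
Let w := wronskian Y Yh.
Let M := ciM Y Yh.
Let T := ciT Y Yh.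
Let P := ciP Y Yh.

(** This is [frame_transfer] for the pair [bframe], [Y], whose Wronskian is -X. *)
Lemma ciM_transfer : exists C, (1%:M - X *m X^†) *m Xh = C *m M.
Proof.
have [C CE] := frame_transfer (frame_bframe R n) FY.
have := CE _ Yh; rewrite bframe_wronskian.
have -> : wronskian bframe Y = - X by exact: bframe_wronskian.
rewrite mppinvN !mulmxN !mulNmx !opprK => /(canRL opprK) ->.
by exists (- C); rewrite mulNmx.
Qed.

Let tT : T^T = T.
Proof.
have /and4P[_ _ _ /eqP tGM] := mppinvP M.
by rewrite /T /ciT -/M linearB /= trmx1 tGM.
Qed.

Let MT : M *m T = 0.
Proof.
have /and4P[/eqP MGM _ _ _] := mppinvP M.
by rewrite /T /ciT -/M mulmxBr mulmx1 mulmxA MGM subrr.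
Qed.

(** With Q = X^† Xh T, the matrix Y Q - Yh T has zero upper block, so its Wronskian with itself
    vanishes; expanded, that Wronskian is P - P^T. *)
Lemma ciP_tr : P^T = P.
Proof.
have [C CE] := ciM_transfer.
pose Q := X^† *m Xh *m T.
have XQ : X *m Q = Xh *m T.
  apply/eqP; rewrite eq_sym -subr_eq0 /Q !mulmxA -mulmxBl -[X in X - _]mul1mx.
  by rewrite -mulmxBl CE -mulmxA MT mulmx0.
have PE : T^T *m w^T *m Q = P by rewrite tT /Q /P /ciP !mulmxA.
clearbody Q.
have uZ : usubmx (Y *m Q - Yh *m T) = 0.
  by rewrite [usubmx _]linearB /= -!mul_usub_mx XQ subrr.
have := wronskian_sub Q T FY FYh.
rewrite wronskianE uZ trmx0 mul0mx mulmx0 subrr => /esym/eqP.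
rewrite subr_eq0 PE => /eqP e.
by rewrite [RHS]e -[in LHS]PE !trmx_mul !trmxK mulmxA.
Qed.

(** Eliminating the outer blocks gives rank X; the remaining border is [M] up to sign, and
    [ind_bordered] compresses the corner to a multiple of [P]. *)
Lemma comp_index_bordered (s : R) : s * s = 1 ->
  ind (block_mx (block_mx 0 (s *: X) (s *: X)^T 0) (col_mx (s *: Xh) (s *: w))
        (col_mx (s *: Xh) (s *: w))^T 0) = (\rank X + (\rank M + ind (- s *: P)))%N.
Proof.
move=> ss; have [C CE] := ciM_transfer.
have EG : s *: X *m (s *: X)^† = X *m X^†.
  by rewrite mppinv_sign // -scalemxAl -scalemxAr scalerA ss scale1r.
have GE : (s *: X)^† *m (s *: X) = X^† *m X.
  by rewrite mppinv_sign // -scalemxAl -scalemxAr scalerA ss scale1r.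
have LE : (1%:M - (s *: X)^† *m (s *: X)) *m (s *: w) = s *: M.
  by rewrite GE -scalemxAr.
have CE' : (1%:M - s *: X *m (s *: X)^†) *m (s *: Xh) =
    C *m ((1%:M - (s *: X)^† *m (s *: X)) *m (s *: w)).
  by rewrite LE EG -!scalemxAr CE.
rewrite (ind_schur_offdiag (trmx0 _ _ _) CE') LE.
have s0 : s != 0 by apply: contra_eq_neq ss => ->; rewrite mul0r eq_sym oner_eq0.
rewrite (eqmx_scale _ s0); congr (_ + _)%N; set D := 0 - _ - _.
have DE : D = - s *: (Xh^T *m X^†^T *m w + w^T *m X^† *m Xh).
  rewrite /D sub0r mppinv_sign //.
  have -> : (s *: Xh)^T = s *: Xh^T by rewrite linearZ.
  have -> : (s *: X^†)^T = s *: X^†^T by rewrite linearZ.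
  have -> : (s *: w)^T = s *: w^T by rewrite linearZ.
  rewrite -!(scalemxAl, scalemxAr) !scalerA -?mulrA ss mulr1.
  by rewrite scaleNr scalerDr opprD.
clearbody D.
have symD : D^T = D.
  rewrite DE linearZ /= linearD /= !trmx_mul !trmxK !mulmxA.
  by rewrite [X in _ *: X]addrC.
have P1 : T *m (w^T *m X^† *m Xh) *m T = P by rewrite /P /ciP !mulmxA.
have P2 : T *m (Xh^T *m X^†^T *m w) *m T = P.
  rewrite -[RHS]ciP_tr -P1 (trmx_mul _ T) (trmx_mul T) tT (trmx_mul _ Xh).
  by rewrite (trmx_mul _ X^†) trmxK !mulmxA.
(* The two summands of [D] are transposes of each other and compress to the same symmetric [P],
   hence the factor 2. *)
have TDT : T *m D *m T = 2 *: (- s *: P).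
  rewrite DE -scalemxAr -scalemxAl [T *m (_ + _)]mulmxDr [(_ + _) *m T]mulmxDl P1 P2.
  by rewrite -mulr2n scalerA [2 * _]mulrC -scalerA scaler_nat.
have TE : T = 1%:M - (s *: M)^† *m (s *: M).
  by rewrite (mppinv_sign _ ss) -scalemxAl -scalemxAr scalerA ss scale1r.
rewrite (ind_bordered _ symD) (eqmx_scale _ s0).
congr (_ + _)%N.
by rewrite -TE TDT ind_scale ?ltr0n // linearZ /= ciP_tr.
Qed.

Lemma comp_index_graph (Ab Ah Ay Gb Gh Gy : 'M[R]_n) :
    Ab^T = Ab -> Ah^T = Ah -> Ay^T = Ay ->
    Gb \in unitmx -> Gh \in unitmx -> Gy \in unitmx ->
    wronskian bframe Yh = Gb^T *m (Ah - Ab) *m Gh ->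
    wronskian bframe Y = Gb^T *m (Ay - Ab) *m Gy ->
    wronskian Yh Y = Gh^T *m (Ay - Ah) *m Gy ->
  (comp_index Y Yh + ind (Ab - Ay) = ind (Ab - Ah) + ind (Ah - Ay))%N /\
  (dual_comp_index Y Yh + ind (Ay - Ab) = ind (Ah - Ab) + ind (Ay - Ah))%N.
Proof.
move=> sb sh sy ub uh uy wbh wby why.
pose A i := nth 0 [:: Ab; Ah; Ay] i; pose G i := nth 0 [:: Gb; Gh; Gy] i.
have sA i : (i <= 2)%N -> (A i)^T = A i by case: i => [|[|[|]]].
have uG i : (i <= 2)%N -> G i \in unitmx by case: i => [|[|[|]]].
pose v i j := (G i)^T *m (A j - A i) *m G j.
have v0 i : v i i = 0 by rewrite /v subrr mulmx0 mul0mx.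
have v01 : v 0%N 1%N = - Xh by rewrite -[LHS]wbh [LHS]bframe_wronskian.
have v02 : v 0%N 2%N = - X by rewrite -[LHS]wby [LHS]bframe_wronskian.
have v12 : v 1%N 2%N = - w^T by rewrite -[LHS]why wronskianT opprK.
have rX : \rank X = (ind (Ay - Ab) + ind (Ab - Ay))%N.
  rewrite -mxrank_opp -bframe_wronskian -/(wronskian bframe Y) wby.
  rewrite mxrankMfree ?row_free_unit // (eqmxMfull _ (_ : row_full _)) ?row_full_unit ?unitmx_tr //.
  by rewrite rank_ind ?opprB // linearB /= sb sy.
pose r := blk_row R n 3.
have rT (i j : 'I_3) : r i *m upper_sym v 3 *m (r j)^T =
    if (i <= j)%N then v i j else (v j i)^T.
  by rewrite mul_blk_row mul_blk_row_tr.
have s3 p (F : nat -> 'M[R]_p) : \sum_(k < 3) F k = F 0%N + F 2%N + F 1%N.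
  by rewrite !big_ord_recl big_ord0 addr0 /= [F 1%N + _]addrC addrA.
have cplt : (r 0%N)^T *m r 0%N + (r 2%N)^T *m r 2%N + (r 1%N)^T *m r 1%N = 1%:M.
  by rewrite -(s3 _ (fun k => (r k)^T *m r k)) blk_row_complete.
(* The blocks of [upper_sym v 3] are the negatives of those in [comp_index_bordered], which is
   therefore used with -s. *)
have main s : s * s = 1 -> ind (s *: upper_sym v 3) = (\rank X + (\rank M + ind (s *: P)))%N.
  move=> ss; rewrite (ind_outer s v0 cplt).
  have := rT ord0 (lift ord0 ord0); have := rT ord_max (lift ord0 ord0).
  have := rT (lift ord0 ord0) (lift ord0 ord0).
  rewrite /= v0 v01 v02 v12 -/r => -> -> ->.
  have -> : (- w^T)^T = - w by rewrite linearN /= trmxK.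
  rewrite !scaler0 !scalerN -!scaleNr.
  by rewrite comp_index_bordered ?mulrNN // opprK.
(* s = 1 gives the comparative index, s = -1 the dual one. Subtracting rank X from the cyclic sum
   cancels its closing term and leaves the opposite one with a minus sign. *)
have := main 1 (mulr1 _); have := main (-1); rewrite mulrNN mulr1 => /(_ erefl).
rewrite scale1r !scaleN1r scale1r (ind_cyclicN sA uG) (ind_cyclic sA uG).
rewrite !big_ord_recr !big_ord0 /= !add0n /A /= rX => e1 e2.
rewrite /comp_index /dual_comp_index -/M -/P; move: e1 e2.
move: (ind (Ab - Ah)) (ind (Ah - Ab)) (ind (Ab - Ay)) (ind (Ay - Ab)) (ind (Ah - Ay)).
by move: (ind (Ay - Ah)) (ind P) (ind (- P)) (\rank M); lia.
Qed.

End Pair.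
End ComparativeIndex.

(** * Focal points *)

(** Telescoping of f - a = g(k+1) - g(k), arranged to avoid truncated subtraction. *)
Lemma sum_exchange (f g a : nat -> nat) m :
    (forall k, (k < m)%N -> f k + g k = a k + g k.+1)%N ->
  (\sum_(0 <= k < m) f k + g 0 = \sum_(k < m) a k + g m)%N.
Proof.
rewrite big_mkord; elim: m => [|m IHm] H; first by rewrite !big_ord0.
have := IHm (fun k km => H k (ltnW km)); have := H m (ltnSn m).
rewrite !big_ord_recr /=; lia.
Qed.

Lemma sum_exchange_rev (f g a : nat -> nat) m :
    (forall k, (k < m)%N -> f k + g k.+1 = a k + g k)%N ->
  (\sum_(0 <= k < m) f k + g m = \sum_(k < m) a k + g 0)%N.
Proof.
rewrite big_mkord; elim: m => [|m IHm] H; first by rewrite !big_ord0.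
have := IHm (fun k km => H k (ltnW km)); have := H m (ltnSn m).
rewrite !big_ord_recr /=; lia.
Qed.

Section System.
Variables (R : rcfType) (n N : nat) (S : nat -> 'M[R]_(n + n)).
Variable Y : nat -> nat -> 'M[R]_(n + n, n).
Hypothesis symplS : forall k, (k <= N)%N -> symplectic (S k).
Hypothesis principalY : forall M, (M <= N.+1)%N -> principal_solution N S M (Y M).

Let V i := Y i 0%N.

Lemma frameV i k : (i <= N.+1)%N -> (k <= N.+1)%N -> frame (Y i k).
Proof. by move=> iN kN; case: (principalY iN) => -[F _] _; apply: F. Qed.

Lemma stepY i k : (i <= N.+1)%N -> (k <= N)%N -> Y i k.+1 = S k *m Y i k.
Proof. by move=> iN kN; case: (principalY iN) => -[_ ->]. Qed.

Lemma diagY i : (i <= N.+1)%N -> Y i i = bframe.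
Proof. by move=> iN; case: (principalY iN). Qed.

Lemma wronskian_const i j k : (i <= N.+1)%N -> (j <= N.+1)%N -> (k <= N.+1)%N ->
  wronskian (Y i k) (Y j k) = wronskian (V i) (V j).
Proof.
move=> iN jN; elim: k => [//|k IHk kN].
by rewrite !stepY // (wronskian_symplectic _ _ (symplS kN)) IHk // ltnW.
Qed.

(** The constant Wronskian is evaluated at time [j], where [Y j] equals [bframe]. *)
Lemma Xblk_wronskian i j : (i <= N.+1)%N -> (j <= N.+1)%N ->
  Xblk Y i j = - wronskian (V j) (V i).
Proof.
move=> iN jN; rewrite -(wronskian_const jN iN jN) diagY //.
by rewrite [wronskian _ _]bframe_wronskian opprK.
Qed.

Lemma Xblk_tr i j : (i <= N.+1)%N -> (j <= N.+1)%N ->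
  (Xblk Y i j)^T = wronskian (V i) (V j).
Proof. by move=> iN jN; rewrite Xblk_wronskian // linearN /= wronskianT opprK. Qed.

Lemma Smx_upper_sym :
  Smx N Y = upper_sym (fun i j => wronskian (V i) (V j)) N.+2.
Proof.
apply: eq_mxblock => i j.
have iN : (i <= N.+1)%N by rewrite -ltnS.
have jN : (j <= N.+1)%N by rewrite -ltnS.
by rewrite /Sblk; case: ifP => _; rewrite ?Xblk_tr.
Qed.

Lemma wronskian_self i : (i <= N.+1)%N -> wronskian (V i) (V i) = 0.
Proof. by move=> iN; case: (frameV iN (leq0n _)). Qed.

Lemma Smx_tr : (Smx N Y)^T = Smx N Y.
Proof.
rewrite Smx_upper_sym; apply: upper_sym_tr => i iN.
by rewrite wronskian_self ?trmx0 // -ltnS.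
Qed.

Lemma Smx_subdiag i : (i <= N)%N ->
  submxblock (Smx N Y) (inord i.+1) (inord i)
      = (submxblock (Smx N Y) (inord i) (inord i.+1))^T
    /\ submxblock (Smx N Y) (inord i.+1) (inord i) = ursubmx (S i).
Proof.
move=> iN; rewrite !mxblockK /Sblk !inordK ?ltnS ?(leqW iN) //.
rewrite ltnn leqnSn; split=> //.
rewrite trmxK /Xblk stepY ?(leqW iN) // diagY ?(leqW iN) //.
by rewrite -mul_usub_mx -[usubmx (S i)]hsubmxK mul_row_col mulmx0 mulmx1 add0r.
Qed.

Lemma symplectic_unit (Z : 'M[R]_(n + n)) : symplectic Z -> Z \in unitmx.
Proof.
move=> sZ; have JJ : Jmx *m Jmx = - 1%:M :> 'M[R]_(n + n).
  rewrite mulmx_block !(mulmx0, mul0mx, add0r, addr0) mulmxN mulNmx mulmx1.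
  by rewrite (scalar_mx_block n n 1) opp_block_mx !oppr0.
have : - (Jmx *m Z^T *m Jmx) *m Z = 1%:M.
  by rewrite mulNmx -!mulmxA (mulmxA Z^T) sZ JJ opprK.
by case/mulmx1_unit.
Qed.

(** Each term of a focal point count thus compares two principal solutions at the same time. *)
Lemma step_bframe k : (k <= N)%N -> S k *m bframe = Y k k.+1.
Proof. by move=> kN; rewrite stepY ?diagY // leqW. Qed.

Lemma step_back_bframe k : (k <= N)%N -> invmx (S k) *m bframe = Y k.+1 k.
Proof.
move=> kN; rewrite -(diagY (i := k.+1)) // stepY // mulmxA.
by rewrite mulVmx ?mul1mx //; exact: symplectic_unit (symplS kN).
Qed.

(** Here a is the sum of ind (A (k+1) - A k), and A0, A1 are the graphs of the outer frames; every
    count differs from a by one index of A0 - A1 or A1 - A0. *)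
Lemma focal_points :
  exists (a : nat) (A0 A1 : 'M[R]_n),
  [/\ \rank (wronskian (V 0) (V N.+1)) = (ind (A1 - A0)%R + ind (A0 - A1)%R)%N,
      ind (- Smx N Y) = (a + ind (A0 - A1)%R)%N,
      backward_focal N S (Y 0%N) = (a + ind (A0 - A1)%R)%N /\
      forward_focal N S (Y N.+1) = (a + ind (A0 - A1)%R)%N,
      (forward_focal N S (Y 0%N) + ind (A1 - A0)%R)%N = a
    & (backward_focal N S (Y N.+1) + ind (A1 - A0)%R)%N = a].
Proof.
have [A [G [sA uG wAG]]] := frames_graph (fun i iN => frameV iN (leq0n N.+1)).
have comp i h b : (i <= N.+1)%N -> (h <= N.+1)%N -> (b <= N.+1)%N ->
    (comp_index (Y i b) (Y h b) + ind (A b - A i) = ind (A b - A h) + ind (A h - A i))%N /\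
    (dual_comp_index (Y i b) (Y h b) + ind (A i - A b) = ind (A h - A b) + ind (A i - A h))%N.
  move=> iN hN bN.
  apply: (comp_index_graph (frameV iN bN) (frameV hN bN) (sA _ bN) (sA _ hN) (sA _ iN)
    (uG _ bN) (uG _ hN) (uG _ iN)).
  - by rewrite -(diagY bN) wronskian_const // wAG.
  - by rewrite -(diagY bN) wronskian_const // wAG.
  - by rewrite wronskian_const // wAG.
have ind_refl i : ind (A i - A i) = 0%N by rewrite subrr ind0.
pose a k := ind (A k.+1 - A k)%R.
exists (\sum_(k < N.+1) a k)%N, (A 0%N), (A N.+1); split.
- rewrite wAG // mxrankMfree ?row_free_unit ?uG //.
  rewrite (eqmxMfull _ (_ : row_full _)) ?row_full_unit ?unitmx_tr ?uG //.
  by rewrite rank_ind ?opprB // linearB /= !sA.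
- rewrite Smx_upper_sym -(ind_cyclicN sA uG); congr (ind (- _)).
  by apply: eq_upper_sym => i j iN jN; rewrite wAG // -ltnS.
(* In all four counts the telescoping potential is an index of a difference of [A k] and the graph
   of the solution's own frame; it vanishes where that solution equals [bframe], so only the value
   at the other end survives. *)
- split.
  + have := @sum_exchange (fun k => dual_comp_index (Y 0%N k) (invmx (S k) *m bframe))
    (fun k => ind (A 0%N - A k)%R) a N.+1.
  rewrite ind_refl addn0; apply=> k kN.
  rewrite (step_back_bframe kN); exact: (comp _ _ _ (leq0n _) kN (ltnW kN)).2.
  + have := @sum_exchange_rev (fun k => comp_index (Y N.+1 k.+1) (S k *m bframe))
    (fun k => ind (A k - A N.+1)%R) a N.+1.
  rewrite ind_refl addn0; apply=> k kN.
  rewrite (step_bframe kN); exact: (comp _ _ _ (leqnn _) (ltnW kN) kN).1.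
- have := @sum_exchange_rev (fun k => comp_index (Y 0%N k.+1) (S k *m bframe))
    (fun k => ind (A k - A 0%N)%R) a N.+1.
  rewrite ind_refl addn0; apply=> k kN.
  rewrite (step_bframe kN); exact: (comp _ _ _ (leq0n _) (ltnW kN) kN).1.
- have := @sum_exchange (fun k => dual_comp_index (Y N.+1 k) (invmx (S k) *m bframe))
    (fun k => ind (A N.+1 - A k)%R) a N.+1.
  rewrite ind_refl addn0; apply=> k kN.
  rewrite (step_back_bframe kN); exact: (comp _ _ _ (leqnn _) kN (ltnW kN)).2.
Qed.

(** * Elimination of the outer frames and the matrix [Sbar] *)

Lemma Kd_wronskian : Kd N Y = (V 0%N)^T *m Jmx *m \mxrow_(j < N) V j.+1.
Proof.
rewrite mul_mxrow; apply: eq_mxrow => j.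
by rewrite Xblk_tr // ltnS ltnW.
Qed.

Lemma Nd_wronskian : Nd N Y = (V N.+1)^T *m Jmx *m \mxrow_(j < N) V j.+1.
Proof.
rewrite mul_mxrow; apply: eq_mxrow => j.
by rewrite Xblk_tr // ltnS ltnW.
Qed.

Let E := Xblk Y N.+1 0.

Lemma Xblk_flip : Xblk Y 0 N.+1 = - E^T.
Proof. by rewrite /E Xblk_tr // Xblk_wronskian. Qed.

Let EE : wronskian (V 0) (V N.+1) = - E.
Proof. by rewrite -Xblk_tr // Xblk_flip linearN /= trmxK. Qed.

Let EE' : wronskian (V N.+1) (V 0) = E^T.
Proof. by rewrite -Xblk_tr. Qed.

Let trEE : E^†^T *m E^T = E *m E^†.
Proof. by have /and4P[_ _ /eqP + _] := mppinvP E; rewrite trmx_mul. Qed.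

Let trEE' : E^T *m E^†^T = E^† *m E.
Proof. by have /and4P[_ _ _ /eqP] := mppinvP E; rewrite trmx_mul. Qed.

Lemma MdE : Md N Y = (1%:M - E *m E^†) *m Kd N Y.
Proof. by rewrite /Md Xblk_flip mppinvN mppinv_tr mulmxN mulNmx opprK trEE. Qed.

(** Two uses of [frame_transfer], one in each direction, on the row of inner frames: both borders
    have the same row space. *)
Lemma Md_transfer : (exists C, Md N Y = C *m Md_tilde N Y) /\
  (exists C, Md_tilde N Y = C *m Md N Y).
Proof.
have F0 : frame (V 0%N) by exact: frameV.
have F1 : frame (V N.+1) by exact: frameV.
split.
  have [C CE] := frame_transfer F0 F1; exists C.
  rewrite MdE Kd_wronskian /Md_tilde Nd_wronskian -/E.
  by have := CE _ (\mxrow_(j < N) V j.+1); rewrite EE mppinvN !mulmxN !mulNmx !opprK.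
have [C CE] := frame_transfer F1 F0; exists C.
rewrite MdE Kd_wronskian /Md_tilde Nd_wronskian -/E.
by have := CE _ (\mxrow_(j < N) V j.+1); rewrite EE' mppinv_tr trEE trEE'.
Qed.

Lemma Sinner_tr : (Sinner N Y)^T = Sinner N Y.
Proof.
rewrite tr_mxblock; apply: eq_mxblock => i j.
by rewrite -[in RHS]Smx_tr tr_submxblock.
Qed.

Lemma Sbar_inner_tr (D := Sinner N Y - Dd N Y - (Dd N Y)^T) : D^T = D.
Proof. by rewrite !linearB /= trmxK Sinner_tr addrAC. Qed.

(** The sign of the border does not affect its row space. *)
Lemma ind_SbarN (L : 'M[R]_(n, \sum_(j < N) n)) :
  ind (- Sbar Y L) = ind (block_mx 0 L L^T (- (Sinner N Y - Dd N Y - (Dd N Y)^T))).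
Proof.
have sD : (- (Sinner N Y - Dd N Y - (Dd N Y)^T))^T = - (Sinner N Y - Dd N Y - (Dd N Y)^T).
  by rewrite linearN /= Sbar_inner_tr.
rewrite /Sbar opp_block_mx oppr0.
have -> : - L^T = (- L)^T by rewrite linearN.
apply: (@ind_border_eqmx _ _ _ _ _ _ _ (- 1%:M) (- 1%:M)) => //.
  by rewrite mulNmx mul1mx.
by rewrite mulNmx mul1mx opprK.
Qed.

Lemma ind_Smx_Sbar :
  ind (- Smx N Y) = (\rank (wronskian (V 0) (V N.+1)) + ind (- Sbar Y (Md_tilde N Y)))%N.
Proof.
(* The diagonal is set to 0 outright, since [ind_outer] asks for it at every index and [V i] is a
   frame only for i <= N + 1. *)
pose w i j := if (i == j)%N then 0 else wronskian (V i) (V j).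
have Sw : Smx N Y = upper_sym w N.+2.
  rewrite Smx_upper_sym; apply: eq_upper_sym => i j iN jN; rewrite /w.
  by case: eqP => // <-; rewrite wronskian_self // -ltnS.
have w0 i : w i i = 0 by rewrite /w eqxx.
pose r k := blk_row R n N.+2 k.
pose c := \mxcol_(i < N) r i.+1.
have cplt : (r 0%N)^T *m r 0%N + (r N.+1)^T *m r N.+1 + c^T *m c = 1%:M.
  rewrite tr_mxcol mul_mxrow_mxcol.
  have sN p (F : nat -> 'M[R]_p) :
      \sum_(k < N.+2) F k = F 0%N + F N.+1 + \sum_(k < N) F k.+1.
    by rewrite big_ord_recl big_ord_recr /= -addrA [F N.+1 + _]addrC.
  by rewrite -(sN _ (fun k => (r k)^T *m r k)) blk_row_complete.
rewrite -scaleN1r Sw (ind_outer (-1) w0 cplt).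
have rT (i j : nat) : (i < N.+2)%N -> (j < N.+2)%N ->
    r i *m upper_sym w N.+2 *m (r j)^T = Sblk Y i j.
  move=> iN jN; have := mul_blk_row_tr (fun j => if (i <= j)%N then w i j else (w j i)^T) (Ordinal jN).
  rewrite -(mul_blk_row (fun i j : 'I_N.+2 => if (i <= j)%N then w i j else (w j i)^T) (Ordinal iN)) /=.
  move=> ->; rewrite /Sblk /w; case: leqP => ij.
    by rewrite Xblk_tr //; case: eqP => // <-; rewrite wronskian_self.
  by rewrite Xblk_tr // (ltn_eqF ij).
have iN (i : 'I_N) : (i.+1 < N.+2)%N by rewrite ltnS ltnW // ltnS.
have cT : c^T = \mxrow_(i < N) (r i.+1)^T by rewrite tr_mxcol.
have rK : r 0%N *m upper_sym w N.+2 *m c^T = Kd N Y.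
  by rewrite cT mul_mxrow; apply: eq_mxrow => i; rewrite rT.
(* The last block row lies below the diagonal, where the reflected blocks carry the opposite
   sign. *)
have rN : r N.+1 *m upper_sym w N.+2 *m c^T = - Nd N Y.
  rewrite cT mul_mxrow -mxrowN; apply: eq_mxrow => i; rewrite rT // /Sblk.
  have iN1 : (i.+1 < N.+1)%N by rewrite ltnS.
  rewrite leqNgt iN1 /= trmxK Xblk_tr //; last exact: ltnW.
  by rewrite Xblk_wronskian // ltnW.
have cc : c *m upper_sym w N.+2 *m c^T = Sinner N Y.
  rewrite cT /c mxcol_mul mul_mxcol_mxrow; apply: eq_mxblock => i j.
  by rewrite rT // mxblockK !inordK.
rewrite rK rN cc.
have -> : w 0%N N.+1 = - E by rewrite /w EE.
rewrite !scalerN !scaleN1r !opprK.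
have [[C CE] _] := Md_transfer.
have CE' : (1%:M - E *m E^†) *m (- Kd N Y) = - C *m Md_tilde N Y.
  by rewrite mulmxN -MdE CE mulNmx.
have sS : (- Sinner N Y)^T = - Sinner N Y by rewrite linearN /= Sinner_tr.
rewrite (ind_schur_offdiag sS CE') -/(Md_tilde N Y) EE mxrank_opp ind_SbarN.
congr (_ + ind (block_mx _ _ _ _))%N.
have DdE : Dd N Y = (Kd N Y)^T *m E^†^T *m Nd N Y.
  by rewrite /Dd Xblk_flip mppinvN mppinv_tr mulmxN mulNmx opprK.
have DdT : (Dd N Y)^T = (Nd N Y)^T *m E^† *m Kd N Y.
  by rewrite DdE !trmx_mul !trmxK mulmxA.
have -> : (- Kd N Y)^T = - (Kd N Y)^T by rewrite linearN.
by rewrite DdT DdE !mulNmx mulmxN !opprD !opprK.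
Qed.

End System.

Theorem theorem4p8 (R : realType) (n N : nat) (S : nat -> 'M[R]_(n + n))
    (Y : nat -> nat -> 'M[R]_(n + n, n))
    (symplS : forall k, (k <= N)%N -> symplectic (S k))
    (principalY : forall M, (M <= N.+1)%N -> principal_solution N S M (Y M)) :
  [/\ forall i j, (i <= j <= N.+1)%N -> (Xblk Y i j)^T = - Xblk Y j i,
      (Smx N Y)^T = Smx N Y,
      forall i, (i <= N)%N ->
        submxblock (Smx N Y) (inord i.+1) (inord i)
          = (submxblock (Smx N Y) (inord i) (inord i.+1))^T
        /\ submxblock (Smx N Y) (inord i.+1) (inord i) = ursubmx (S i),
      backward_focal N S (Y 0%N) = ind (- Smx N Y)
        /\ forward_focal N S (Y N.+1) = ind (- Smx N Y)
    & (1 <= N)%N ->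
      [/\ forward_focal N S (Y 0%N) = ind (- Sbar Y (Md_tilde N Y)),
          backward_focal N S (Y N.+1) = ind (- Sbar Y (Md_tilde N Y))
        & ind (- Sbar Y (Md N Y)) = ind (- Sbar Y (Md_tilde N Y))]].
Proof.
have [a [A0 [A1 [rE iS [b0 f1] f0 b1]]]] := focal_points symplS principalY.
have iSbar := ind_Smx_Sbar symplS principalY.
split.
- move=> i j /andP[ij jN]; have iN := leq_trans ij jN.
  by rewrite (Xblk_tr symplS principalY) // (Xblk_wronskian symplS principalY) // opprK.
- exact: Smx_tr symplS principalY.
- exact: (Smx_subdiag principalY).
- by rewrite b0 f1 iS.
(* The rank of the outer Wronskian is ind (A1 - A0) + ind (A0 - A1); the second term cancels against
   the one in ind (-S). *)
have iL : (ind (- Sbar Y (Md_tilde N Y))%R + ind (A1 - A0)%R)%N = a.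
  by move: iSbar; rewrite iS rE; lia.
move=> _; split.
- by apply: (@addIn (ind (A1 - A0)%R)); rewrite f0 iL.
- by apply: (@addIn (ind (A1 - A0)%R)); rewrite b1 iL.
have [[C1 CE1] [C2 CE2]] := Md_transfer symplS principalY.
rewrite !(ind_SbarN symplS principalY); apply: ind_border_eqmx CE1 CE2.
by rewrite linearN /= (Sbar_inner_tr symplS principalY).
Qed.
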